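(* Let $u:\mathbb{R}^2\to\mathbb{R}$ be a smooth function satisfying $$\Delta u+e^{2u}\le 0\quad\text{in }\mathbb{R}^2 .$$ If also $\int_{\mathbb{R}^2}e^{2u}\,dx<\infty$, then $\mathrm{diam}_g(\mathbb{R}^2)\le 2\pi$, where $g=e^{2u}\delta$.
   Context: $\delta$ is the Euclidean metric on $\mathbb{R}^2$. For a Riemannian metric $g$ on $\mathbb{R}^2$, $d_g(x,y)$ is the infimum of the $g$-lengths of piecewise smooth curves from $x$ to $y$ (for $g=e^{2u}\delta$ the length of $\gamma:[a,b]\to\mathbb{R}^2$ is $\int_a^b e^{u(\gamma(t))}|\gamma'(t)|\,dt$), and $\mathrm{diam}_g(\mathbb{R}^2)=\sup_{x,y\in\mathbb{R}^2} d_g(x,y)$. The metric $g$ need not be complete. *)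

(* Defs.v *)
From HB Require Import structures.
From mathcomp Require Import all_boot all_order all_algebra.
From mathcomp Require Import all_classical all_reals all_analysis.

Set Implicit Arguments.
Unset Strict Implicit.
Unset Printing Implicit Defensive.

Import Order.TTheory GRing.Theory Num.Theory.
Import numFieldNormedType.Exports.

Local Open Scope classical_set_scope.
Local Open Scope ring_scope.

(* All iterated directional derivatives are Frechet differentiable; when V is
   finite-dimensional (below V is R or R * R) this is C^infinity. *)
Definition smooth (R : realType) (V W : normedModType R) (f : V -> W) : Prop :=
  forall (vs : seq V) (p : V),
    differentiable (foldr (fun v h => 'D_v h) f vs) p.

(* The canonical norm on R * R is the max norm, hence this definition. *)
Definition euclidean_norm (R : realType) (p : R * R) : R :=
  Num.sqrt (p.1 ^+ 2 + p.2 ^+ 2).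

Definition laplacian (R : realType) (u : R * R -> R) (p : R * R) : R :=
  'D_((1, 0) : R * R) ('D_((1, 0) : R * R) u) p +
  'D_((0, 1) : R * R) ('D_((0, 1) : R * R) u) p.

(* A curve on [a, b] is a total function on R whose values outside [a, b] are
   irrelevant.  Each piece is the restriction of a smooth function to a closed
   subinterval; consecutive pieces agree at the breakpoints, so gamma is
   continuous on [a, b]. *)
Definition piecewise_smooth (R : realType) (a b : R) (gamma : R -> R * R)
    : Prop :=
  exists2 s : seq R, itv_partition a b s &
    forall i, (i < size s)%N ->
      exists2 c : R -> R * R, smooth c &
        {in `[nth b (a :: s) i, nth b (a :: s) i.+1], gamma =1 c}.

(* Length for the metric e^{2u} delta.  The derivative of gamma may fail to
   exist at finitely many parameters, which the Lebesgue integral ignores. *)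
Definition conformal_length (R : realType) (u : R * R -> R) (a b : R)
    (gamma : R -> R * R) : \bar R :=
  \int[@lebesgue_measure R]_(t in `[a, b])
    (expR (u (gamma t)) * euclidean_norm (derive1 gamma t))%:E.

Definition conformal_dist (R : realType) (u : R * R -> R) (x y : R * R)
    : \bar R :=
  ereal_inf [set l : \bar R | exists a b gamma,
    [/\ a < b, piecewise_smooth a b gamma, gamma a = x, gamma b = y &
        l = conformal_length u a b gamma]].

Definition conformal_diam (R : realType) (u : R * R -> R) : \bar R :=
  ereal_sup [set d : \bar R | exists x y, d = conformal_dist u x y].

(* Main.v *)
Require Import Defs.
From HB Require Import structures.
From mathcomp Require Import all_boot all_order all_algebra.
From mathcomp Require Import all_classical all_reals all_analysis measurable_realfun.
From mathcomp Require Import ring lra.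

Set Implicit Arguments.
Unset Strict Implicit.
Unset Printing Implicit Defensive.

Import Order.TTheory GRing.Theory Num.Theory.
Import numFieldNormedType.Exports.

Local Open Scope classical_set_scope.
Local Open Scope ring_scope.

(** The metric g = e^{2u} delta has Gauss curvature - e^{-2u} Delta u >= 1.  If
    g were complete, the theorem of Bonnet and Myers would bound its diameter
    by pi.  Without completeness its argument still shows that every point can
    be joined to infinity by curves of length at most pi + eps: up to the
    boundary of any large square, minimal curves exist, and one of length
    more than pi would be unstable.  Finite area says that infinity is a
    single point for g: there are arbitrarily large squares whose boundary is
    as short as one likes.  Going from x to the boundary of such a square,
    along it, and back to y costs at most 2 pi + eps.

    The Bonnet-Myers part is done on chains p_0, ..., p_N of points instead of
    curves, so that neither the existence nor the regularity of geodesics is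
    an issue.  A chain from x to a corner of the square minimising
    sum_k e^{2 u(p_k)} |p_{k+1} - p_k|^2 exists by compactness
    (minimizer_exists); it is cut at the first index M where it meets the
    boundary.  Write v_k = N (p_{k+1} - p_k) and w_k = |v_k|^2.  The
    Euler-Lagrange equation is a difference equation for the momenta
    e^{2 u(p_k)} v_k; it keeps them within a bounded distance of one another,
    and the energy bound then bounds all the velocities, uniformly in N
    (velocity_bound).  Hence the v_k vary by O(1/N) per step, they satisfy the
    geodesic equation
      N (v_k - v_{k-1}) = w_k grad u - 2 (grad u . v_k) v_k + O(1/N),
    and e^{2 u(p_k)} w_k = L + O(1/N) for a constant L.

    The second variation is evaluated on phi_k J v_{k-1}, with J the rotation
    by a quarter turn and phi the half sine wave on {0, ..., M}.  Modulo O(1/N)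
    it equals L times a sum of
      phi'^2 - 2 phi phi' A + phi^2 (D^2u(Jv, Jv) + A^2 - B^2),
    where A = grad u . v and B = grad u . Jv (second_variation_normal).
    Summation by parts turns the middle term into phi^2 A', and
    A' = D^2u(v, v) + B^2 - A^2 by the geodesic equation, so that everything
    collapses to phi'^2 + phi^2 w Delta u (jacobi_by_parts), which is at most
    phi'^2 - L phi^2 up to O(1/N).  As phi is an eigenfunction of the discrete
    Dirichlet problem, minimality gives L <= (N pi / M)^2 + O(1/N)
    (energy_gap), that is, a length (M / N) sqrt L of at most pi + O(1/N)
    (discrete_geodesic_length).

    For the short squares, Fubini says that the integrals of e^{2u} over
    vertical and over horizontal lines are integrable functions of the
    position of the line.  Since 1/s is not integrable at infinity, some
    large S has all four lines through the sides of the square of size S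
    carrying at most c/S (short_lines).  By the inequality of arithmetic and
    geometric means, a segment of length 2S on such a line has g-length
    O(sqrt c) (side_length_le). *)

(** * Calculus in the plane, uniformly on squares *)

Section calculus.
Variable R : realType.
Implicit Types (f : R * R -> R) (p q w : R * R).

Definition dx f : R * R -> R := 'D_((1, 0) : R * R) f.
Definition dy f : R * R -> R := 'D_((0, 1) : R * R) f.
(** The first-order term of f at p in the direction w, in coordinates. *)
Definition grad_dot f p w : R := dx f p * w.1 + dy f p * w.2.

Lemma smooth_derive f v : smooth f -> smooth ('D_v f).
Proof. by move=> sf vs p; have := sf (vs ++ [:: v]) p; rewrite foldr_cat. Qed.

Lemma smooth_differentiable f p : smooth f -> differentiable f p.
Proof. by move=> sf; exact: (sf [::] p). Qed.

Lemma smooth_continuous f : smooth f -> continuous f.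
Proof. by move=> sf p; exact/differentiable_continuous/smooth_differentiable. Qed.

Lemma derive_grad_dot f p w : differentiable f p -> 'D_w f p = grad_dot f p w.
Proof.
move=> df; rewrite /grad_dot /dx /dy !deriveE//.
have -> : w = w.1 *: ((1, 0) : R * R) + w.2 *: ((0, 1) : R * R).
  rewrite [LHS]surjective_pairing; congr pair => /=;
    by rewrite /GRing.scale/= !(mulr1, mulr0, addr0, add0r).
by rewrite linearD !linearZ/= /GRing.scale/= !(mulr1, mulr0, addr0, add0r) mulrC [in X in _ + X]mulrC.
Qed.

(** Everything about a smooth function of the plane is obtained from its restrictions to lines. *)
Lemma is_derive_line f p w (s : R) : smooth f ->
  is_derive s 1 (fun s : R => f (p + s *: w)) (grad_dot f (p + s *: w) w).
Proof.
move=> sf.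
have df := smooth_differentiable (p + s *: w) sf.
rewrite -derive_grad_dot//.
have E : (fun h : R => h^-1 *: ((f \o shift (p + s *: w)) (h *: w) - f (p + s *: w)))
     = (fun h : R => h^-1 *: (((fun s : R => f (p + s *: w)) \o shift s) (h *: 1) - f (p + s *: w))).
  apply/funext => h /=; congr (_ *: (f _ - _)).
  rewrite (_ : h *: (1 : R) = h); last exact: mulr1.
  by rewrite /shift scalerDl addrCA.
have dw : derivable f (p + s *: w) w by exact: diff_derivable.
split; first by rewrite /derivable -E.
by rewrite /derive -E.
Qed.

Definition square (S : R) : set (R * R) := [set p | `|p.1| <= S /\ `|p.2| <= S].

Lemma square_compact S : compact (square S).
Proof.
have -> : square S = `[-S, S]%classic `*` `[-S, S]%classic.
  by apply/seteqP; split => p; rewrite /square/= !in_itv/= !ler_norml.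
by apply: compact_setX; exact: segment_compact.
Qed.

Lemma square_bounded f S : continuous f ->
  exists2 C, 0 <= C & forall p, square S p -> `|f p| <= C.
Proof.
move=> cf.
have : compact (f @` square S).
  by apply: continuous_compact; [exact: continuous_subspaceT|exact: square_compact].
move=> /compact_bounded[M [_ HM]].
exists (`|M| + 1) => [|p Kp]; first by rewrite addr_ge0.
apply: (HM (`|M| + 1)) => /=; last by exists p.
by rewrite (le_lt_trans (ler_norm _))// ltrDl.
Qed.

(** Lengths of displacements enter only through error terms, where any norm will do; this one needs no square root. *)
Definition l1 w : R := `|w.1| + `|w.2|.

Lemma square_segment S p q (s : R) : square S p -> square S q ->
  0 <= s <= 1 -> square S (p + s *: (q - p)).
Proof.
move=> [p1 p2] [q1 q2] /andP[s0 s1].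
have H (a b : R) : `|a| <= S -> `|b| <= S -> `|a + s * (b - a)| <= S.
  rewrite !ler_norml => /andP[? ?] /andP[? ?].
  by apply/andP; split; nra.
by split; rewrite /= H.
Qed.

Lemma square_mean_value f S p q : smooth f -> square S p -> square S q ->
  exists2 c, square S c /\ l1 (c - p) <= l1 (q - p) &
             f q - f p = grad_dot f c (q - p).
Proof.
move=> sf Kp Kq.
have D (s : R) : is_derive s 1 (fun s : R => f (p + s *: (q - p)))
   (grad_dot f (p + s *: (q - p)) (q - p)) by exact: is_derive_line.
have cf : {within `[0, 1], continuous (fun s : R => f (p + s *: (q - p)))}.
  apply: continuous_subspaceT => x; apply: differentiable_continuous.
  by apply/derivable1_diffP; case: (D x).
have [s s01] := MVT ltr01 (fun x _ => D x) cf.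
rewrite scale0r addr0 scale1r subr0 mulr1.
rewrite (_ : p + (q - p) = q); last by rewrite addrC subrK.
move=> E; exists (p + s *: (q - p)) => //; move: s01; rewrite in_itv/= => /andP[s0 s1].
split; first by apply: square_segment => //; rewrite !ltW.
rewrite (_ : p + s *: (q - p) - p = s *: (q - p)); last by rewrite addrC addKr.
rewrite /l1/= !normrM (ger0_norm (ltW s0)) -mulrDr ler_piMl ?addr_ge0//.
exact: ltW.
Qed.

Lemma grad_dot_le f p w C : `|dx f p| <= C -> `|dy f p| <= C ->
  `|grad_dot f p w| <= C * l1 w.
Proof.
move=> Hx Hy; rewrite /grad_dot /l1 (le_trans (ler_normD _ _))// mulrDr.
by rewrite !normrM lerD// ler_wpM2r.
Qed.

Lemma square_lipschitz f S : smooth f ->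
  exists2 C, 0 <= C & forall p q, square S p -> square S q ->
    `|f q - f p| <= C * l1 (q - p).
Proof.
move=> sf.
have [Cx Cx0 Hx] := square_bounded S (smooth_continuous (smooth_derive (1, 0) sf)).
have [Cy Cy0 Hy] := square_bounded S (smooth_continuous (smooth_derive (0, 1) sf)).
exists (Cx + Cy) => [|p q Kp Kq]; first exact: addr_ge0.
have [c [Kc _] ->] := square_mean_value sf Kp Kq.
by apply: grad_dot_le; [rewrite (le_trans (Hx _ Kc))// lerDl|rewrite (le_trans (Hy _ Kc))// lerDr].
Qed.

Lemma l1_ge0 w : 0 <= l1 w. Proof. exact: addr_ge0. Qed.

(** The gradient at the intermediate point given by the mean value theorem
    differs from that at p by a multiple of l1 (q - p), gradients being
    Lipschitz on the square. *)
Lemma square_taylor f S : smooth f ->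
  exists2 C, 0 <= C & forall p q, square S p -> square S q ->
    `|f q - f p - grad_dot f p (q - p)| <= C * l1 (q - p) ^+ 2.
Proof.
move=> sf.
have [Cx Cx0 Hx] := square_lipschitz S (smooth_derive (1, 0) sf).
have [Cy Cy0 Hy] := square_lipschitz S (smooth_derive (0, 1) sf).
exists (Cx + Cy) => [|p q Kp Kq]; first exact: addr_ge0.
have [c [Kc cl] ->] := square_mean_value sf Kp Kq.
have -> : grad_dot f c (q - p) - grad_dot f p (q - p) =
   (dx f c - dx f p) * (q - p).1 + (dy f c - dy f p) * (q - p).2.
  by rewrite /grad_dot; ring.
have cx : `|dx f c - dx f p| <= Cx * l1 (q - p).
  by apply: le_trans (Hx _ _ Kp Kc) _; rewrite ler_wpM2l.
have cy : `|dy f c - dy f p| <= Cy * l1 (q - p).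
  by apply: le_trans (Hy _ _ Kp Kc) _; rewrite ler_wpM2l.
rewrite (le_trans (ler_normD _ _))// !normrM.
have : `|dx f c - dx f p| * `|(q - p).1| <= Cx * l1 (q - p) * `|(q - p).1| by rewrite ler_wpM2r.
have : `|dy f c - dy f p| * `|(q - p).2| <= Cy * l1 (q - p) * `|(q - p).2| by rewrite ler_wpM2r.
have := l1_ge0 (q - p).
rewrite /l1; set a := `|(q - p).1|; set b := `|(q - p).2| => ab h1 h2.
have a0 : 0 <= a := normr_ge0 _.
have b0 : 0 <= b := normr_ge0 _.
have ? : 0 <= Cx * ((a + b) * b) by rewrite !mulr_ge0.
have ? : 0 <= Cy * ((a + b) * a) by rewrite !mulr_ge0.
lra.
Qed.

End calculus.

(** * Second variation modulo O(1/n) *)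

Section bigO.
Variables (R : realType) (T : Type) (D : set T) (n : T -> R).
Hypothesis n1 : forall t, D t -> 1 <= n t.
Implicit Types f g : T -> R.

(** The index t stands for a discrete geodesic together with one of its indices
    k, and n t for its number of steps.  Boundedness is uniform in t, and eqh is
    equality up to O(1/n).  As eqh is a congruence on bounded functions, a
    formula may be simplified by replacing its constituents one at a time. *)
Definition bdd f := exists C, forall t, D t -> `|f t| <= C.
Definition eqh f g := bdd (fun t => n t * (f t - g t)).

Lemma bdd_cst c : bdd (fun=> c).
Proof. by exists `|c|. Qed.

Lemma bddD f g : bdd f -> bdd g -> bdd (fun t => f t + g t).
Proof.
move=> [a Ha] [b Hb]; exists (a + b) => t Dt.
by rewrite (le_trans (ler_normD _ _))// lerD// (Ha, Hb).
Qed.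

Lemma bddN f : bdd f -> bdd (fun t => - f t).
Proof. by move=> [a Ha]; exists a => t Dt; rewrite normrN Ha. Qed.

Lemma bddM f g : bdd f -> bdd g -> bdd (fun t => f t * g t).
Proof.
by move=> [a Ha] [b Hb]; exists (a * b) => t Dt; rewrite normrM ler_pM// (Ha, Hb).
Qed.

Lemma bddX f k : bdd f -> bdd (fun t => f t ^+ k).
Proof.
move=> [a Ha]; exists (a ^+ k) => t Dt.
by rewrite normrX lerXn2r// ?nnegrE ?Ha// (le_trans _ (Ha _ Dt)).
Qed.

Lemma bdd_le f g : (forall t, D t -> `|f t| <= `|g t|) -> bdd g -> bdd f.
Proof. by move=> fg [a Ha]; exists a => t Dt; rewrite (le_trans (fg _ Dt))// Ha. Qed.

Lemma bdd_eq f g : (forall t, D t -> f t = g t) -> bdd g -> bdd f.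
Proof. by move=> fg; apply: bdd_le => t Dt; rewrite fg. Qed.

Lemma eqh_refl f : eqh f f.
Proof. by exists 0 => t _; rewrite subrr mulr0 normr0. Qed.

Lemma eqh_eq f f' g g' : (forall t, D t -> f t = f' t) ->
  (forall t, D t -> g t = g' t) -> eqh f' g' -> eqh f g.
Proof. by move=> ff gg; apply: bdd_eq => t Dt; rewrite ff// gg. Qed.

Lemma eqh_sym f g : eqh f g -> eqh g f.
Proof. by move=> [a Ha]; exists a => t Dt; rewrite -normrN -mulrN opprB Ha. Qed.

Lemma eqh_trans g f h : eqh f g -> eqh g h -> eqh f h.
Proof.
by move=> fg gh; apply: bdd_eq (bddD fg gh) => t Dt; rewrite -mulrDr addrA subrK.
Qed.

Lemma eqhD f f' g g' : eqh f f' -> eqh g g' ->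
  eqh (fun t => f t + g t) (fun t => f' t + g' t).
Proof. by move=> fg gh; apply: bdd_eq (bddD fg gh) => t Dt; rewrite /=; ring. Qed.

Lemma eqhN f f' : eqh f f' -> eqh (fun t => - f t) (fun t => - f' t).
Proof. by move=> fg; apply: bdd_eq (bddN fg) => t Dt; rewrite /=; ring. Qed.

Lemma bdd_eqh f g : eqh f g -> bdd g -> bdd f.
Proof.
move=> fg bg; have h : bdd (fun t => f t - g t).
  apply: bdd_le fg => t Dt; rewrite normrM ler_peMl// ger0_norm ?n1//.
  by rewrite (le_trans ler01)// n1.
by apply: bdd_eq (bddD h bg) => t Dt; rewrite subrK.
Qed.

Lemma eqhM f f' g g' : bdd f' -> bdd g' -> eqh f f' -> eqh g g' ->
  eqh (fun t => f t * g t) (fun t => f' t * g' t).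
Proof.
move=> bf bg ff gg; have bf1 := bdd_eqh ff bf.
apply: bdd_eq (bddD (bddM bf1 gg) (bddM ff bg)) => t Dt; rewrite /=; ring.
Qed.

Lemma eqhX f f' k : bdd f' -> eqh f f' ->
  eqh (fun t => f t ^+ k) (fun t => f' t ^+ k).
Proof.
move=> bf ff; elim: k => [|k IH]; first exact: eqh_refl.
apply: (@eqh_eq _ (fun t => f t * f t ^+ k) _ (fun t => f' t * f' t ^+ k)).
- by move=> t _; rewrite exprS.
- by move=> t _; rewrite exprS.
- by apply: eqhM => //; exact: bddX.
Qed.

End bigO.

(** These follow the syntax of an expression down to the hypotheses on its atoms. *)
Ltac bdd_tac := repeat first [assumption | apply: bddD | apply: bddN
  | apply: bddM | apply: bddX | exact: bdd_cst].
Ltac eqh_tac := repeat first [assumption | exact: eqh_refl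
  | apply: eqhD | apply: eqhN | apply: eqhM; [assumption|by bdd_tac|by bdd_tac| |]
  | apply: eqhX; [assumption|by bdd_tac|]].

Section asymptotics.
Variables (R : realType) (T : Type) (D : set T) (n : T -> R).
Hypothesis n1 : forall t, D t -> 1 <= n t.
(** The functions stand for the following: a and b for the values of e^{2u} at p_k and
    p_{k-1}, (gx, gy) and (gx', gy') for the gradients of u there, hxx, hxy, hyx, hyy
    for the second derivatives of u at p_k, v and w for the velocities v_k and
    v_{k-1}, f and fd for phi_k and the difference quotient of phi at k, and L for the
    nearly constant value of e^{2u} |v|^2. *)
Variables a b gx gy gx' gy' hxx hxy hyx hyy v1 v2 w1 w2 f fd L : T -> R.
Notation bdd := (bdd D).
Notation eqh := (eqh D n).
Hypothesis a0 : forall t, D t -> a t != 0.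
Hypotheses (ba : bdd a) (bai : bdd (fun t => (a t)^-1)).
Hypotheses (bgx : bdd gx) (bgy : bdd gy).
Hypotheses (bxx : bdd hxx) (bxy : bdd hxy) (byx : bdd hyx) (byy : bdd hyy).
Hypotheses (bv1 : bdd v1) (bv2 : bdd v2) (bw1 : bdd w1) (bw2 : bdd w2).
Hypotheses (bf : bdd f) (bfd : bdd fd).

Definition sqv t := v1 t ^+ 2 + v2 t ^+ 2.
Definition sqw t := w1 t ^+ 2 + w2 t ^+ 2.
Definition gv t := gx t * v1 t + gy t * v2 t.
Definition gJv t := gy t * v1 t - gx t * v2 t.

Hypothesis EL1 : forall t, D t -> a t * (v1 t - (n t)^-1 * sqv t * gx t) = b t * w1 t.
Hypothesis EL2 : forall t, D t -> a t * (v2 t - (n t)^-1 * sqv t * gy t) = b t * w2 t.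
Hypothesis Ta : eqh (fun t => n t * (a t - b t))
  (fun t => 2 * a t * (gx t * w1 t + gy t * w2 t)).
Hypothesis Tgx : eqh (fun t => n t * (gx t - gx' t))
  (fun t => hxx t * w1 t + hxy t * w2 t).
Hypothesis Tgy : eqh (fun t => n t * (gy t - gy' t))
  (fun t => hyx t * w1 t + hyy t * w2 t).

Let n0 t : D t -> n t != 0.
Proof. by move=> /n1 h; rewrite gt_eqF// (lt_le_trans ltr01). Qed.

Let bsqv : bdd sqv. Proof. by rewrite /sqv; bdd_tac. Qed.

Let nvw1 t : D t -> n t * (v1 t - w1 t) =
  sqv t * gx t - (a t)^-1 * (n t * (a t - b t)) * w1 t.
Proof.
move=> Dt; apply: (mulfI (a0 Dt)); have := EL1 Dt => E.
transitivity (n t * (a t * v1 t - b t * w1 t - (a t - b t) * w1 t)); first by ring.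
by rewrite -E; field; rewrite a0// n0.
Qed.

Let nvw2 t : D t -> n t * (v2 t - w2 t) =
  sqv t * gy t - (a t)^-1 * (n t * (a t - b t)) * w2 t.
Proof.
move=> Dt; apply: (mulfI (a0 Dt)); have := EL2 Dt => E.
transitivity (n t * (a t * v2 t - b t * w2 t - (a t - b t) * w2 t)); first by ring.
by rewrite -E; field; rewrite a0// n0.
Qed.

Let bnab : bdd (fun t => n t * (a t - b t)).
Proof. by apply: (bdd_eqh n1 Ta); bdd_tac. Qed.

Lemma eqvw1 : eqh w1 v1.
Proof. by apply: eqh_sym; apply: bdd_eq nvw1 _; bdd_tac. Qed.

Lemma eqvw2 : eqh w2 v2.
Proof. by apply: eqh_sym; apply: bdd_eq nvw2 _; bdd_tac. Qed.

(** The geodesic equation of the conformal metric.  The Euler-Lagrange equation is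
    a v - b w = a |v|^2 grad u / n; the difference a - b, which contributes the
    term 2 (grad u . v) v, is evaluated by the Taylor expansion of e^{2u}. *)
Lemma accel1 : eqh (fun t => n t * (v1 t - w1 t))
  (fun t => sqv t * gx t - 2 * gv t * v1 t).
Proof.
have := eqvw1; have := eqvw2 => h2 h1.
apply: (@eqh_trans _ _ _ _ (fun t => sqv t * gx t - (a t)^-1 * (2 * a t * (gx t * v1 t + gy t * v2 t)) * v1 t)); last first.
  by apply: eqh_eq (@eqh_refl _ _ _ _ _) => // t Dt; rewrite /gv; field; exact: a0.
apply: eqh_eq nvw1 (fun _ _ => erefl) _.
have Ta' : eqh (fun t => n t * (a t - b t)) (fun t => 2 * a t * (gx t * v1 t + gy t * v2 t)).
  by apply: eqh_trans Ta _; eqh_tac.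
by eqh_tac.
Qed.

Lemma accel2 : eqh (fun t => n t * (v2 t - w2 t))
  (fun t => sqv t * gy t - 2 * gv t * v2 t).
Proof.
have := eqvw1; have := eqvw2 => h2 h1.
apply: (@eqh_trans _ _ _ _ (fun t => sqv t * gy t - (a t)^-1 * (2 * a t * (gx t * v1 t + gy t * v2 t)) * v2 t)); last first.
  by apply: eqh_eq (@eqh_refl _ _ _ _ _) => // t Dt; rewrite /gv; field; exact: a0.
apply: eqh_eq nvw2 (fun _ _ => erefl) _.
have Ta' : eqh (fun t => n t * (a t - b t)) (fun t => 2 * a t * (gx t * v1 t + gy t * v2 t)).
  by apply: eqh_trans Ta _; eqh_tac.
by eqh_tac.
Qed.

(** Geodesics have constant speed: the derivative of e^{2u} contributes
    2 a (grad u . v) |v|^2 and the acceleration contributes the opposite. *)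
Lemma speed_drift : eqh (fun t => n t * (a t * sqv t - b t * sqw t)) (fun=> 0).
Proof.
have h1 := eqvw1; have h2 := eqvw2; have k1 := accel1; have k2 := accel2.
have bgv : bdd gv by rewrite /gv; bdd_tac.
have Ta' : eqh (fun t => n t * (a t - b t)) (fun t => 2 * a t * (gx t * v1 t + gy t * v2 t)).
  by apply: eqh_trans Ta _; eqh_tac.
apply: (@eqh_trans _ _ _ _ (fun t => (n t * (a t - b t)) * (w1 t ^+ 2 + w2 t ^+ 2)
  + a t * ((n t * (v1 t - w1 t)) * (v1 t + w1 t) + (n t * (v2 t - w2 t)) * (v2 t + w2 t)))).
  by apply: eqh_eq (@eqh_refl _ _ _ _ _) => // t Dt; rewrite /sqv /sqw; ring.
apply: (@eqh_trans _ _ _ _ (fun t => (2 * a t * (gx t * v1 t + gy t * v2 t)) * (v1 t ^+ 2 + v2 t ^+ 2)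
  + a t * ((sqv t * gx t - 2 * gv t * v1 t) * (v1 t + v1 t) + (sqv t * gy t - 2 * gv t * v2 t) * (v2 t + v2 t)))).
  by eqh_tac.
by apply: eqh_eq (@eqh_refl _ _ _ _ _) => // t Dt; rewrite /sqv /gv; ring.
Qed.

Definition hess2 t x y := hxx t * x ^+ 2 + (hxy t + hyx t) * (x * y) + hyy t * y ^+ 2.

(** The second variation at index k of the energy on the field f J w, with (d1, d2)
    the difference quotient of this field; the velocity w of the previous step
    is used so that the last value of the field involves no velocity beyond the
    end of the chain. *)
Definition var2 t : R :=
  let xi1 := - (f t * w2 t) in let xi2 := f t * w1 t in
  let d1 := - (fd t * v2 t + f t * (n t * (v2 t - w2 t))) in
  let d2 := fd t * v1 t + f t * (n t * (v1 t - w1 t)) in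
  let U := gx t * xi1 + gy t * xi2 in
  a t * ((2 * U ^+ 2 + hess2 t xi1 xi2) * sqv t
         + 4 * U * (v1 t * d1 + v2 t * d2) + (d1 ^+ 2 + d2 ^+ 2)).

(** The factor f + (f + fd / n) is the sum of phi_k and phi_{k+1}; with it the middle
    term is an exact difference of phi^2 and can be summed by parts without error. *)
Definition jacobi t : R :=
  fd t ^+ 2 - (f t + (f t + (n t)^-1 * fd t)) * fd t * gv t
  + f t ^+ 2 * (hess2 t (- v2 t) (v1 t) + gv t ^+ 2 - gJv t ^+ 2).

(** The geodesic equation gives the acceleration; what remains is a polynomial
    identity.  With A = gv and B = gJv, the first term of var2 contributes 2 B^2, the
    mixed one - 4 B^2, and the square of the acceleration A^2 + B^2. *)
Lemma second_variation_normal : eqh (fun t => a t * sqv t) L -> bdd L ->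
  eqh var2 (fun t => L t * jacobi t).
Proof.
move=> aL bL.
have h1 := eqvw1; have h2 := eqvw2; have k1 := accel1; have k2 := accel2.
have bgv : bdd gv by rewrite /gv; bdd_tac.
have bgJv : bdd gJv by rewrite /gJv; bdd_tac.
have ff : eqh (fun t => f t + (n t)^-1 * fd t) f.
  by apply: bdd_eq bfd => t Dt; field; exact: n0.
have bff := bdd_eqh n1 ff bf; have ff' := eqh_sym ff.
pose d1 t := - (fd t * v2 t + f t * (sqv t * gy t - 2 * gv t * v2 t)).
pose d2 t := fd t * v1 t + f t * (sqv t * gx t - 2 * gv t * v1 t).
pose U t := gx t * (- (f t * v2 t)) + gy t * (f t * v1 t).
apply: (@eqh_trans _ _ _ _ (fun t => a t * ((2 * U t ^+ 2 + hess2 t (- (f t * v2 t)) (f t * v1 t)) * sqv t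
         + 4 * U t * (v1 t * d1 t + v2 t * d2 t) + (d1 t ^+ 2 + d2 t ^+ 2)))).
  by rewrite /var2 /U /d1 /d2 /hess2/=; eqh_tac.
apply: (@eqh_trans _ _ _ _ (fun t => (a t * sqv t) * (fd t ^+ 2 - (f t + f t) * fd t * gv t
  + f t ^+ 2 * (hess2 t (- v2 t) (v1 t) + gv t ^+ 2 - gJv t ^+ 2)))).
  apply: eqh_eq (@eqh_refl _ _ _ _ _) => // t Dt.
  by rewrite /U /d1 /d2 /hess2 /gv /gJv /sqv; ring.
by rewrite /jacobi /hess2; eqh_tac.
Qed.

(** The rate of change of grad u . v along the geodesic is
    D^2u(v, v) + (grad u . J v)^2 - (grad u . v)^2.  The squares cancel, and
    D^2u(v, v) + D^2u(Jv, Jv) = |v|^2 Delta u, in which the mixed derivatives cancel. *)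
Lemma jacobi_by_parts :
  eqh (fun t => fd t ^+ 2 + f t ^+ 2 *
    (n t * (gv t - (gx' t * w1 t + gy' t * w2 t)) + hess2 t (- v2 t) (v1 t) + gv t ^+ 2 - gJv t ^+ 2))
  (fun t => fd t ^+ 2 + f t ^+ 2 * (sqv t * (hxx t + hyy t))).
Proof.
have h1 := eqvw1; have h2 := eqvw2; have k1 := accel1; have k2 := accel2.
have bgv : bdd gv by rewrite /gv; bdd_tac.
have bgJv : bdd gJv by rewrite /gJv; bdd_tac.
have Tx : eqh (fun t => n t * (gx t - gx' t)) (fun t => hxx t * v1 t + hxy t * v2 t).
  by apply: eqh_trans Tgx _; eqh_tac.
have Ty : eqh (fun t => n t * (gy t - gy' t)) (fun t => hyx t * v1 t + hyy t * v2 t).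
  by apply: eqh_trans Tgy _; eqh_tac.
apply: (@eqh_trans _ _ _ _ (fun t => fd t ^+ 2 + f t ^+ 2 *
    ((gx t * (n t * (v1 t - w1 t)) + gy t * (n t * (v2 t - w2 t)) +
     (n t * (gx t - gx' t)) * w1 t + (n t * (gy t - gy' t)) * w2 t) + hess2 t (- v2 t) (v1 t) + gv t ^+ 2 - gJv t ^+ 2))).
  by apply: eqh_eq (@eqh_refl _ _ _ _ _) => // t Dt; rewrite /gv; ring.
apply: (@eqh_trans _ _ _ _ (fun t => fd t ^+ 2 + f t ^+ 2 *
    ((gx t * (sqv t * gx t - 2 * gv t * v1 t) + gy t * (sqv t * gy t - 2 * gv t * v2 t) +
     (hxx t * v1 t + hxy t * v2 t) * v1 t + (hyx t * v1 t + hyy t * v2 t) * v2 t) + hess2 t (- v2 t) (v1 t) + gv t ^+ 2 - gJv t ^+ 2))).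
  by rewrite /hess2; eqh_tac.
apply: eqh_eq (@eqh_refl _ _ _ _ _) => // t Dt.
by rewrite /hess2 /gv /gJv /sqv; ring.
Qed.

End asymptotics.

(** * The half sine wave on a discrete interval *)

Section trig.
Variable R : realType.
Implicit Types x y : R.

Lemma sin_lipschitz x y : `|sin y - sin x| <= `|y - x|.
Proof.
wlog xy : x y / x <= y.
  move=> H; have [/H//|/ltW/H] := leP x y.
  by rewrite distrC (distrC x y).
have [z _ ->] := MVT_segment xy (fun z _ => is_derive_sin z)
  (continuous_subspaceT (@continuous_sin R)).
by rewrite normrM ler_piMl// cos_max.
Qed.

Lemma one_sub_cos_le x : 2 - 2 * cos x <= x ^+ 2.
Proof.
have -> : 2 - 2 * cos x = (2 * sin (x / 2)) ^+ 2.
  rewrite [in LHS](_ : x = (x / 2) *+ 2); last by rewrite mulr2n; field.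
  by rewrite cos_mulr2n cos2sin2 exprMn; rewrite mulr2n; ring.
rewrite -[leRHS]real_normK ?num_real// -[leLHS]real_normK ?num_real// lerXn2r ?nnegrE//.
have := sin_lipschitz 0 (x / 2); rewrite sin0 !subr0 => h.
by rewrite normrM ger0_norm// -ler_pdivlMl// (le_trans h)// normrM [in X in _ * X]ger0_norm// mulrC.
Qed.

(** The first Dirichlet eigenfunction of the second difference on {0, ..., M}. *)
Definition profile (M k : nat) : R := sin (k%:R * (pi / M%:R)).

Lemma profile0 M : profile M 0 = 0.
Proof. by rewrite /profile mul0r sin0. Qed.

Lemma profileM M : profile M M = 0.
Proof.
case: M => [|M]; first exact: profile0.
by rewrite /profile mulrC divfK ?pnatr_eq0// sinpi.
Qed.

Lemma profile_max M k : `|profile M k| <= 1.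
Proof. exact: sin_max. Qed.

Lemma profile_step M k : `|profile M k.+1 - profile M k| <= pi / M%:R.
Proof.
apply: le_trans (sin_lipschitz _ _) _.
rewrite -mulrBl -natrB// subSnn mul1r ger0_norm//.
by rewrite divr_ge0// pi_ge0.
Qed.

Lemma profile_dirichlet M : (0 < M)%N ->
  \sum_(k < M) (profile M k.+1 - profile M k) ^+ 2 =
  (2 - 2 * cos (pi / M%:R)) * \sum_(k < M) profile M k ^+ 2.
Proof.
move=> M0; set t := pi / M%:R.
rewrite mulr_sumr; apply/eqP; rewrite -subr_eq0 -sumrB; apply/eqP.
(* The two sides differ termwise by an exact difference: the square comes from
   phi_{k+1}^2 - phi_k^2, the cosine from the sum of phi_k cos(k t) sin(t). *)
pose F k : R := profile M k ^+ 2 + cos (k%:R * t + (k%:R * t - t)) / 2.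
rewrite (eq_bigr (fun k : 'I_M => F k.+1 - F k)) => [|k _].
  rewrite -(big_mkord xpredT (fun k => F k.+1 - F k)) telescope_sumr//.
  rewrite /F profile0 profileM mul0r add0r sub0r.
  have -> : M%:R * t = pi by rewrite /t mulrC divfK// pnatr_eq0 -lt0n.
  have -> : pi + (pi - t) = - t + pi *+ 2 by rewrite mulr2n; ring.
  by rewrite cosD2pi subrr.
rewrite /F /profile -/t -natr1 mulrDl mul1r.
set x := k%:R * t.
rewrite (_ : x + t + (x + t - t) = x + x + t); last by ring.
rewrite (_ : x + (x - t) = x + x - t); last by ring.
rewrite (cosD _ t) cosB !sinD !cosD.
by field.
Qed.

Lemma profile_norm M : (1 < M)%N ->
  \sum_(k < M) profile M k ^+ 2 = M%:R / 2.
Proof.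
move=> M1; have M0 := ltnW M1; set t : R := pi / M%:R.
have t0 : sin t != 0.
  rewrite gt_eqF// sin_gt0_pi// /t divr_gt0 ?pi_gt0 ?ltr0n//=.
  by rewrite ltr_pdivrMr ?ltr0n// ltr_pMr ?pi_gt0// ltr1n.
apply: (mulfI t0).
(* A primitive of sin(t) sin(k t)^2, by sin^2 = (1 - cos(2 k t)) / 2. *)
pose F k : R := k%:R * sin t / 2 - sin (k%:R * t + (k%:R * t - t)) / 4.
rewrite mulr_sumr (eq_bigr (fun k : 'I_M => F k.+1 - F k)) => [|k _].
  rewrite -(big_mkord xpredT (fun k => F k.+1 - F k)) telescope_sumr//.
  rewrite /F !mul0r !(add0r, sub0r).
  have -> : M%:R * t = pi by rewrite /t mulrC divfK// pnatr_eq0 -lt0n.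
  have -> : pi + (pi - t) = - t + pi *+ 2 by rewrite mulr2n; ring.
  by rewrite sinD2pi sinN; field.
rewrite /F /profile -/t -natr1 [(_ + 1) * t]mulrDl mul1r.
set x := k%:R * t.
rewrite (_ : x + t + (x + t - t) = x + x + t); last by ring.
rewrite (_ : x + (x - t) = x + x - t); last by ring.
rewrite (sinD _ t) sinB !sinD !cosD.
by have h := cos2sin2 x; field: h.
Qed.

Lemma sum_by_parts (F A : nat -> R) M : F 0%N = 0 ->
  \sum_(k < M) ((F k.+1 - F k) * A k + F k * (A k - A k.-1)) = F M * A M.-1.
Proof.
move=> F0; elim: M => [|M IH]; first by rewrite big_ord0 F0 mul0r.
by rewrite big_ord_recr/= IH; ring.
Qed.

End trig.

(** * Discrete geodesics and their speed *)

Section discrete_geodesics.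
Variables (R : realType) (u : R * R -> R).
Implicit Types (p xi : nat -> R * R) (N M k : nat) (w z : R * R).

Definition conf (q : R * R) : R := expR (2 * u q).
Definition nsq w : R := w.1 ^+ 2 + w.2 ^+ 2.
Definition dot w z : R := w.1 * z.1 + w.2 * z.2.
Definition hess (q w : R * R) : R :=
  grad_dot (dx u) q w * w.1 + grad_dot (dy u) q w * w.2.
Definition vel N p k : R * R :=
  (N%:R * ((p k.+1).1 - (p k).1), N%:R * ((p k.+1).2 - (p k).2)).

(** The term of index k of the second derivative of the energy at p in the
    direction xi, up to the factor 2 / N^2. *)
Definition index_form N p xi k : R :=
  conf (p k) * ((2 * grad_dot u (p k) (xi k) ^+ 2 + hess (p k) (xi k)) * nsq (vel N p k)
   + 4 * grad_dot u (p k) (xi k) * dot (vel N p k) (vel N xi k) + nsq (vel N xi k)).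

(** The properties of a minimal chain, cut at the index M, on which the estimates
    rest.  The constants of these estimates are to depend on S, E and d only. *)
Record discrete_geodesic (S E d : R) N M p : Prop := DiscreteGeodesic {
  dg_N : (0 < N)%N;
  dg_M : (0 < M <= N)%N;
  dg_square : forall k, (k <= M)%N -> square S (p k);
  dg_energy : \sum_(k < M) conf (p k) * nsq (vel N p k) <= E * N%:R;
  dg_euler1 : forall k, (0 < k < M)%N ->
    conf (p k) * ((vel N p k).1 - N%:R^-1 * nsq (vel N p k) * dx u (p k)) =
    conf (p k.-1) * (vel N p k.-1).1;
  dg_euler2 : forall k, (0 < k < M)%N ->
    conf (p k) * ((vel N p k).2 - N%:R^-1 * nsq (vel N p k) * dy u (p k)) =
    conf (p k.-1) * (vel N p k.-1).2;
  dg_index : forall xi, xi 0%N = 0 -> (forall k, (M <= k)%N -> xi k = 0) ->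
    0 <= \sum_(k < M) index_form N p xi k;
  dg_far : d <= l1 (p M - p 0%N) }.

Lemma conf_gt0 q : 0 < conf q. Proof. exact: expR_gt0. Qed.
Lemma nsq_ge0 w : 0 <= nsq w. Proof. by rewrite addr_ge0// sqr_ge0. Qed.

Hypothesis usmooth : smooth u.

Lemma square_conf_bounds S : exists2 A, 1 <= A & forall q, square S q ->
  conf q <= A /\ (conf q)^-1 <= A.
Proof.
have [C C0 H] := square_bounded S (smooth_continuous usmooth).
exists (expR (2 * C)) => [|q /H]; first by rewrite -expR0 ler_expR mulr_ge0.
rewrite ler_norml => /andP[h1 h2]; rewrite /conf -expRN !ler_expR; split; lra.
Qed.

Section velocity.
Variables (S E d : R).
Hypotheses (E0 : 0 < E) (d0 : 0 < d).

(** By the Euler-Lagrange equation consecutive momenta differ by at most G / N times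
    the energy of a step, and these energies add up to at most E N. *)
Lemma momentum_drift G : 0 <= G ->
  (forall q, square S q -> `|dx u q| <= G /\ `|dy u q| <= G) ->
  forall N M p, discrete_geodesic S E d N M p -> forall k, (k < M)%N ->
  `|conf (p k) * (vel N p k).1 - conf (p 0%N) * (vel N p 0%N).1| <= G * E /\
  `|conf (p k) * (vel N p k).2 - conf (p 0%N) * (vel N p 0%N).2| <= G * E.
Proof.
move=> G0 HG N M p dg k kM.
have N0 : 0 < N%:R :> R by rewrite ltr0n dg.(dg_N).
pose e j := conf (p j) * nsq (vel N p j).
have e0 j : 0 <= e j by rewrite mulr_ge0 ?nsq_ge0// ltW// conf_gt0.
suff: `|conf (p k) * (vel N p k).1 - conf (p 0%N) * (vel N p 0%N).1| <= N%:R^-1 * G * \sum_(j < k.+1) e j /\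
  `|conf (p k) * (vel N p k).2 - conf (p 0%N) * (vel N p 0%N).2| <= N%:R^-1 * G * \sum_(j < k.+1) e j.
  have h : N%:R^-1 * G * \sum_(j < k.+1) e j <= G * E.
    rewrite -mulrA ler_pdivrMl// mulrCA ler_wpM2l// mulrC.
    apply: le_trans dg.(dg_energy).
    rewrite -!(big_mkord xpredT e) (@big_cat_nat _ _ _ k.+1 0%N M)//= lerDl.
    by apply: sumr_ge0 => i _; exact: e0.
  by move=> [h1 h2]; split; [exact: le_trans h1 h|exact: le_trans h2 h].
elim: k kM => [|k IH] kM.
  have h : 0 <= N%:R^-1 * G * \sum_(j < 1) e j.
    by rewrite !mulr_ge0 ?invr_ge0 ?(ltW N0)// sumr_ge0// => i _; exact: e0.
  by rewrite !subrr !normr0.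
have [h1 h2] := IH (ltnW kM).
have [G1 G2] := HG _ (dg.(dg_square) (ltnW kM)).
have kM' : (0 < k.+1 < M)%N by [].
have step (g x y c : R) : `|g| <= G -> c = conf (p k.+1) * (x - N%:R^-1 * nsq (vel N p k.+1) * g) ->
   `|c - y| <= N%:R^-1 * G * \sum_(j < k.+1) e j ->
   `|conf (p k.+1) * x - y| <= N%:R^-1 * G * \sum_(j < k.+2) e j.
  move=> gG -> H; rewrite big_ord_recr/= mulrDr.
  rewrite (_ : _ - y = conf (p k.+1) * (x - N%:R^-1 * nsq (vel N p k.+1) * g) - y + N%:R^-1 * g * e k.+1); last by rewrite /e; ring.
  rewrite (le_trans (ler_normD _ _))// lerD//.
  by rewrite normrM (ger0_norm (e0 _)) normrM (@ger0_norm _ N%:R^-1) ?invr_ge0 ?(ltW N0)// ler_wpM2r// ler_wpM2l// invr_ge0 ltW.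
split; first by apply: step G1 _ h1; rewrite dg.(dg_euler1).
by apply: step G2 _ h2; rewrite dg.(dg_euler2).
Qed.

(** A bounded energy does not allow a displacement of at least d in a short time. *)
Lemma duration_ge A : 1 <= A -> (forall q, square S q -> (conf q)^-1 <= A) ->
  forall N M p, discrete_geodesic S E d N M p ->
  N%:R <= 2 * A * E / d ^+ 2 * M%:R.
Proof.
move=> A1 HA N M p dg.
have N0 : 0 < N%:R :> R by rewrite ltr0n dg.(dg_N).
have A0 : 0 < A by rewrite (lt_le_trans ltr01).
have AE : 0 < A * E by rewrite mulr_gt0.
pose lam := d / (2 * A * E).
have lam0 : 0 < lam by rewrite divr_gt0// -mulrA mulr_gt0.
(* The inequality is used with the weight lam that balances the energy against d. *)
have amgm (x : R) : `|x| <= lam * x ^+ 2 + (4 * lam)^-1.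
  rewrite -(real_normK (num_real x)); set y := `|x|.
  have h : 0 <= (2 * lam * y - 1) ^+ 2 / (4 * lam).
    by rewrite mulr_ge0 ?sqr_ge0// invr_ge0 mulr_ge0// ltW.
  rewrite -subr_ge0 (_ : _ - y = (2 * lam * y - 1) ^+ 2 / (4 * lam))//.
  by field; rewrite gt_eqF.
have far : d * N%:R <= \sum_(k < M) (`|(vel N p k).1| + `|(vel N p k).2|).
  rewrite (le_trans (ler_wpM2r (ltW N0) dg.(dg_far)))//.
  rewrite /l1 big_split/= mulrDl.
  have tele (F : nat -> R) : `|F M - F 0%N| * N%:R <= \sum_(k < M) `|N%:R * (F k.+1 - F k)|.
    rewrite -{1}(ger0_norm (ltW N0)) -normrM mulrC -(telescope_sumr F)// big_mkord mulr_sumr.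
    exact: ler_norm_sum.
  by rewrite lerD//; [exact: (tele (fun k => (p k).1))|exact: (tele (fun k => (p k).2))].
have up : \sum_(k < M) (`|(vel N p k).1| + `|(vel N p k).2|) <=
   lam * A * (E * N%:R) + M%:R / (2 * lam).
  apply: (@le_trans _ _ (\sum_(k < M) (lam * A * (conf (p k) * nsq (vel N p k)) + (2 * lam)^-1))).
    apply: ler_sum => k _.
    have kM : square S (p k) by apply: dg.(dg_square); exact: ltnW.
    have := HA _ kM; rewrite invf_ple ?posrE ?conf_gt0// => ha.
    have h1 := amgm (vel N p k).1; have h2 := amgm (vel N p k).2.
    have h3 : nsq (vel N p k) <= A * (conf (p k) * nsq (vel N p k)).
      by rewrite mulrA ler_peMl ?nsq_ge0// -ler_pdivrMl// mulr1.
    apply: (@le_trans _ _ (lam * nsq (vel N p k) + (2 * lam)^-1)).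
      rewrite /nsq mulrDr (_ : (2 * lam)^-1 = (4 * lam)^-1 + (4 * lam)^-1); last by field; rewrite gt_eqF.
      lra.
    by rewrite lerD2r -mulrA ler_wpM2l// ltW.
  rewrite big_split/= -mulr_sumr sumr_const card_ord -[X in _ + X <= _]mulr_natl lerD//.
  by rewrite ler_wpM2l ?dg.(dg_energy)// mulr_ge0 ?(ltW A0)// ltW.
have := le_trans far up.
have -> : lam * A * (E * N%:R) = d / 2 * N%:R by rewrite /lam; field; rewrite !gt_eqF.
have -> : M%:R / (2 * lam) = (A * E * M%:R) / d by rewrite /lam; field; rewrite !gt_eqF.
rewrite -lerBlDl -mulrBl ler_pdivlMr// => h.
rewrite mulrAC ler_pdivlMr ?exprn_gt0//.
lra.
Qed.

(** The energy bounds the mean square of the momenta, since the duration M / N is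
    bounded below; having bounded oscillation, the momenta are then bounded
    individually. *)
Lemma velocity_bound : exists2 C, 0 <= C &
  forall N M p, discrete_geodesic S E d N M p ->
  N%:R <= C * M%:R /\
  forall k, (k < M)%N -> `|(vel N p k).1| <= C /\ `|(vel N p k).2| <= C.
Proof.
have [A A1 HA] := square_conf_bounds S.
have [Gx Gx0 HGx] := square_bounded S (smooth_continuous (smooth_derive (1, 0) usmooth)).
have [Gy Gy0 HGy] := square_bounded S (smooth_continuous (smooth_derive (0, 1) usmooth)).
have A0 : 0 < A by rewrite (lt_le_trans ltr01).
pose G := Gx + Gy; pose K := 2 * A * E / d ^+ 2.
have G0 : 0 <= G by exact: addr_ge0.
have K0 : 0 <= K by rewrite divr_ge0 ?sqr_ge0// !mulr_ge0// ltW.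
have GE0 : 0 <= G * E by rewrite mulr_ge0// ltW.
pose Q := 2 * A * E * K + 2 * (G * E) ^+ 2.
have Q0 : 0 <= Q.
  have ? : 0 <= 2 * A * E by rewrite !mulr_ge0 ?(ltW A0) ?(ltW E0).
  by apply: addr_ge0; [exact: mulr_ge0|rewrite mulr_ge0 ?sqr_ge0].
have C0 : 0 <= A * (1 + Q + G * E) by rewrite mulr_ge0 ?(ltW A0)// addr_ge0// addr_ge0.
exists (K + A * (1 + Q + G * E)); first by rewrite addr_ge0.
move=> N M p dg.
have N0 : 0 < N%:R :> R by rewrite ltr0n dg.(dg_N).
have M0 : 0 < M%:R :> R by rewrite ltr0n; case/andP: dg.(dg_M).
have NK : N%:R <= K * M%:R.
  by apply: duration_ge dg => // q /HA[].
split; first by rewrite (le_trans NK)// ler_wpM2r ?(ltW M0)// lerDl.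
have drift := momentum_drift G0 (fun q Kq => conj (le_trans (HGx q Kq) (ler_wpDr Gy0 (lexx _))) (le_trans (HGy q Kq) (ler_wpDl Gx0 (lexx _)))) dg.
(* The two components of the momentum are treated alike; V is the velocity and P the momentum. *)
have main (P V : nat -> R) : (forall k, (k < M)%N -> P k = conf (p k) * V k) ->
   (forall k, V k ^+ 2 <= nsq (vel N p k)) ->
   (forall k, (k < M)%N -> `|P k - P 0%N| <= G * E) ->
   forall k, (k < M)%N -> `|V k| <= K + A * (1 + Q + G * E).
  move=> PV Vn dr.
  (* The initial momentum is compared with the k-th one, and the comparison averaged over k. *)
  have P0 : P 0%N ^+ 2 <= Q.
    have h : M%:R * P 0%N ^+ 2 <= 2 * A * (E * N%:R) + M%:R * (2 * (G * E) ^+ 2).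
      rewrite mulr_natl -[X in _ *+ X](card_ord M) -sumr_const.
      rewrite [X in _ <= _ + X]mulr_natl -[X in _ <= _ + _ *+ X](card_ord M) -sumr_const.
      apply: (@le_trans _ _ (\sum_(k < M) (2 * A * (conf (p k) * nsq (vel N p k)) + 2 * (G * E) ^+ 2))).
        apply: ler_sum => k _.
        have Kk : square S (p k) by apply: dg.(dg_square); exact: ltnW.
        have h1 : `|P 0%N - P k| ^+ 2 <= (G * E) ^+ 2.
          by rewrite lerXn2r ?nnegrE// distrC dr.
        have h2 : P k ^+ 2 <= A * (conf (p k) * nsq (vel N p k)).
          rewrite PV// exprMn expr2 -mulrA.
          have c0 := ltW (conf_gt0 (p k)).
          apply: ler_pM => //; first exact: mulr_ge0 c0 (sqr_ge0 _).
            by have [] := HA _ Kk.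
          exact: ler_wpM2l.
        rewrite real_normK ?num_real// in h1.
        have h3 : 0 <= (P 0%N - P k - P k) ^+ 2 := sqr_ge0 _.
        lra.
      rewrite big_split/= lerD2r -mulr_sumr ler_wpM2l ?dg.(dg_energy)//.
      by rewrite mulr_ge0// ltW.
    rewrite -(ler_pM2l M0) (le_trans h)// /Q mulrDr lerD2r.
    have := ler_wpM2l (mulr_ge0 (mulr_ge0 (ler0n _ 2) (ltW A0)) (ltW E0)) NK.
    lra.
  have P01 : `|P 0%N| <= 1 + Q.
    have h3 : 0 <= (`|P 0%N| - 1) ^+ 2 := sqr_ge0 _.
    rewrite -(real_normK (num_real (P 0%N))) in P0.
    have := normr_ge0 (P 0%N); move: P0 h3; set y := `|_| => P0 h3 y0.
    lra.
  move=> k kM.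
  have Kk : square S (p k) by apply: dg.(dg_square); exact: ltnW.
  have -> : V k = (conf (p k))^-1 * P k by rewrite PV// mulKf// gt_eqF// conf_gt0.
  rewrite normrM [X in X * _]ger0_norm; last by rewrite invr_ge0 ltW// conf_gt0.
  apply: (@le_trans _ _ (A * (1 + Q + G * E))); last by rewrite lerDr.
  apply: ler_pM; rewrite ?invr_ge0 ?(ltW (conf_gt0 _))//; first by have [] := HA _ Kk.
  rewrite -[P k](subrK (P 0%N)) addrC (le_trans (ler_normD _ _))//.
  by rewrite lerD// dr.
move=> k kM; split.
- apply: (main (fun k => conf (p k) * (vel N p k).1) (fun k => (vel N p k).1)) => // j.
    by rewrite /nsq lerDl sqr_ge0.
  by case/drift.
- apply: (main (fun k => conf (p k) * (vel N p k).2) (fun k => (vel N p k).2)) => // j.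
    by rewrite /nsq lerDr sqr_ge0.
  by case/drift.
Qed.

End velocity.
End discrete_geodesics.

(** * Asymptotics along discrete geodesics *)

(** Both bounds on e^y - 1 come from 1 + x <= e^x, at y and at - y. *)
Lemma expR_taylor (R : realType) (y : R) :
  `|expR y - 1 - y| <= y ^+ 2 * (1 + expR y).
Proof.
have h1 := expR_ge1Dx y; have h2 := expR_ge1Dx (- y).
have e0 := expR_gt0 y.
have h3 : expR y - 1 <= y * expR y.
  have := ler_wpM2r (ltW e0) h2; rewrite expRN mulVf ?gt_eqF//; lra.
rewrite ger0_norm; last by lra.
have [y0|y0] := leP 0 y.
  have := ler_wpM2l y0 h3; have := sqr_ge0 y; lra.
have h4 : y * (expR y - 1) <= y * y by rewrite ler_nM2l//; lra.
have h5 : 0 <= y * y * expR y by rewrite mulr_ge0 ?(ltW e0)// -expr2 sqr_ge0.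
lra.
Qed.

Section length_bound.
Variables (R : realType) (u : R * R -> R) (usmooth : smooth u).
Variables (S E d : R).
Hypotheses (E0 : 0 < E) (d0 : 0 < d).

Let T := (nat * nat * (nat -> R * R) * nat)%type.
Let tN (t : T) := t.1.1.1.
Let tM (t : T) := t.1.1.2.
Let tp (t : T) := t.1.2.
Let tk (t : T) := t.2.
Let D : set T := [set t | discrete_geodesic u S E d (tN t) (tM t) (tp t) /\
  (0 < tk t < tM t)%N].
Let n (t : T) : R := (tN t)%:R.
Let cur (t : T) : R * R := tp t (tk t).
Let prv (t : T) : R * R := tp t (tk t).-1.
Let v (t : T) := vel (tN t) (tp t) (tk t).
Let w (t : T) := vel (tN t) (tp t) (tk t).-1.
Let f (t : T) := profile R (tM t) (tk t).
Let fd (t : T) := n t * (profile R (tM t) (tk t).+1 - profile R (tM t) (tk t)).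

Let n1 t : D t -> 1 <= n t.
Proof. by move=> [dg _]; rewrite ler1n; exact: dg.(dg_N). Qed.

Let n0 t : D t -> n t != 0.
Proof. by move=> /n1 h; rewrite gt_eqF// (lt_le_trans ltr01). Qed.

Let Dcur t : D t -> square S (cur t).
Proof. by move=> [dg /andP[_ kM]]; apply: dg.(dg_square); exact: ltnW. Qed.

Let Dprv t : D t -> square S (prv t).
Proof. by move=> [dg /andP[_ kM]]; apply: dg.(dg_square); rewrite (leq_trans (leq_pred _))// ltnW. Qed.

Let prvE t : D t -> prv t - cur t = (- (n t)^-1) *: w t.
Proof.
move=> Dt; case: (Dt) => _ /andP[k0 _].
rewrite /w /vel /prv /cur prednK// -/(n t).
apply: injective_projections => /=; rewrite /GRing.scale/=; field; exact: n0.
Qed.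

Let bdd_smooth g : smooth g -> bdd D (fun t => g (cur t)).
Proof.
move=> sg; have [C C0 H] := square_bounded S (smooth_continuous sg).
by exists C => t /Dcur/H.
Qed.

Let bdd_vel : [/\ bdd D (fun t => (v t).1), bdd D (fun t => (v t).2),
  bdd D (fun t => (w t).1) & bdd D (fun t => (w t).2)].
Proof.
have [C C0 H] := velocity_bound usmooth S E0 d0.
have Hv t : D t -> `|(v t).1| <= C /\ `|(v t).2| <= C.
  by move=> [dg /andP[_ kM]]; have [_] := H _ _ _ dg; exact.
have Hw t : D t -> `|(w t).1| <= C /\ `|(w t).2| <= C.
  by move=> [dg /andP[_ kM]]; have [_] := H _ _ _ dg; apply; rewrite (leq_ltn_trans (leq_pred _)).
by split; exists C => t Dt; [have [] := Hv t Dt|have [] := Hv t Dt|have [] := Hw t Dt|have [] := Hw t Dt].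
Qed.

Lemma eqh_taylor g : smooth g ->
  eqh D n (fun t => n t * (g (cur t) - g (prv t)))
          (fun t => dx g (cur t) * (w t).1 + dy g (cur t) * (w t).2).
Proof.
move=> sg; have [_ _ b1 b2] := bdd_vel.
have [C C0 H] := square_taylor S sg.
have bl : bdd D (fun t => C * (l1 (w t)) ^+ 2).
  have babs h : bdd D h -> bdd D (fun t => `|h t|).
    by move=> [K HK]; exists K => t Dt; rewrite normr_id HK.
  by apply: bddM; [exact: bdd_cst|apply: bddX; apply: bddD; exact: babs].
apply: bdd_le bl => t Dt.
have n0t : 0 < n t by rewrite (lt_le_trans ltr01)// n1.
have := H _ _ (Dcur Dt) (Dprv Dt); rewrite prvE//.
set X := _ - _ - _ => HX.
rewrite (_ : _ * _ = - (n t ^+ 2 * X)); last first.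
  by rewrite /X /grad_dot/= /GRing.scale/=; field; exact: n0.
rewrite normrN normrM (ger0_norm (sqr_ge0 _)) (ger0_norm (x := C * _)); last by rewrite mulr_ge0// sqr_ge0.
rewrite (le_trans (ler_wpM2l (sqr_ge0 _) HX))//.
rewrite /l1/= /GRing.scale/= !normrM normrN (@ger0_norm _ (n t)^-1) ?invr_ge0 ?(ltW n0t)//.
rewrite le_eqVlt; apply/orP; left; apply/eqP; field; exact: n0.
Qed.

Let a (t : T) := conf u (cur t).
Let b (t : T) := conf u (prv t).

Lemma a_neq0 t : D t -> a t != 0.
Proof. by move=> _; rewrite gt_eqF// conf_gt0. Qed.

Lemma bdd_a : bdd D a /\ bdd D (fun t => (a t)^-1).
Proof.
have [A A1 H] := square_conf_bounds usmooth S.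
split; exists A => t /Dcur/H[h1 h2]; rewrite ger0_norm ?invr_ge0 ?(ltW (conf_gt0 _ _))//.
Qed.

(** Writing b = a e^y with y = - 2 (u(p_k) - u(p_{k-1})) = O(1/n), the remainder
    e^y - 1 - y is O(1/n^2). *)
Lemma eqh_conf : eqh D n (fun t => n t * (a t - b t))
  (fun t => 2 * a t * (dx u (cur t) * (w t).1 + dy u (cur t) * (w t).2)).
Proof.
have [_ _ bw1 bw2] := bdd_vel; have [ba bai] := bdd_a.
have bgx := bdd_smooth (smooth_derive (1, 0) usmooth).
have bgy := bdd_smooth (smooth_derive (0, 1) usmooth).
have bb : bdd D b.
  have [A A1 H] := square_conf_bounds usmooth S.
  by exists A => t /Dprv/H[h1 _]; rewrite ger0_norm ?(ltW (conf_gt0 _ _)).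
pose G t := dx u (cur t) * (w t).1 + dy u (cur t) * (w t).2.
have bG : bdd D G by rewrite /G /dx /dy; bdd_tac.
have hu := eqh_taylor usmooth.
have bY := bdd_eqh n1 hu bG.
pose Y t := n t * (u (cur t) - u (prv t)).
pose y t := - (2 * (u (cur t) - u (prv t))).
have bba t : D t -> b t = a t * expR (y t).
  by move=> Dt; rewrite /a /b /conf -expRD; congr expR; rewrite /y; ring.
have brem : bdd D (fun t => n t ^+ 2 * (expR (y t) - 1 - y t)).
  have h : bdd D (fun t => (2 * Y t) ^+ 2 * (1 + b t * (a t)^-1)) by rewrite /Y; bdd_tac.
  apply: bdd_le h => t Dt.
  have eb : expR (y t) = b t * (a t)^-1 by rewrite bba// mulrAC mulfV ?mul1r// a_neq0.
  rewrite -eb normrM (ger0_norm (sqr_ge0 _)) [leRHS]ger0_norm; last first.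
    by rewrite mulr_ge0 ?sqr_ge0// addr_ge0// expR_ge0.
  rewrite (_ : (2 * Y t) ^+ 2 = n t ^+ 2 * y t ^+ 2); last by rewrite /Y /y; ring.
  by rewrite -mulrA ler_wpM2l ?sqr_ge0// expR_taylor.
have := bddD (bddN (bddM ba brem)) (bddM ba (bddM (bdd_cst D 2) hu)).
apply: bdd_eq => t Dt; rewrite (bba t Dt) /y -/(G t); ring.
Qed.

Lemma bdd_fd : bdd D fd.
Proof.
have [C C0 H] := velocity_bound usmooth S E0 d0.
exists (C * pi) => t [dg _].
have [hN _] := H _ _ _ dg.
have M0 : 0 < (tM t)%:R :> R by rewrite ltr0n; case/andP: dg.(dg_M).
rewrite /fd normrM ger0_norm ?ler0n//.
rewrite (le_trans (ler_wpM2l (ler0n _ _) (profile_step R _ _)))//.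
by rewrite mulrCA mulrC ler_wpM2r ?pi_ge0// ler_pdivrMr.
Qed.

(** Each step changes the speed by O(1/N^2), and there are at most N steps. *)
Lemma speed_drift_chain : exists2 C, 0 <= C & forall N M p,
  discrete_geodesic u S E d N M p -> forall k, (k < M)%N ->
  N%:R * `|conf u (p k) * nsq (vel N p k) - conf u (p 0%N) * nsq (vel N p 0%N)| <= C.
Proof.
have [bv1 bv2 bw1 bw2] := bdd_vel; have [ba bai] := bdd_a.
have bgx := bdd_smooth (smooth_derive (1, 0) usmooth).
have bgy := bdd_smooth (smooth_derive (0, 1) usmooth).
have [C HC] := @speed_drift R T D n n1 a b (fun t => dx u (cur t)) (fun t => dy u (cur t))
  (fun t => (v t).1) (fun t => (v t).2) (fun t => (w t).1) (fun t => (w t).2)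
  a_neq0 ba bai bgx bgy bv1 bv2 bw1 bw2
  (fun t Dt => (Dt.1).(dg_euler1) Dt.2) (fun t Dt => (Dt.1).(dg_euler2) Dt.2) eqh_conf.
exists `|C| => // N M p dg.
have N0 : 0 < N%:R :> R by rewrite ltr0n dg.(dg_N).
have st k : (k < M)%N -> N%:R ^+ 2 * `|conf u (p k) * nsq (vel N p k) - conf u (p 0%N) * nsq (vel N p 0%N)| <= k%:R * `|C|.
  elim: k => [|k IH] kM; first by rewrite subrr normr0 mulr0 mul0r.
  have h := HC (N, M, p, k.+1) (conj dg kM).
  rewrite -[_ - _](subrKA (conf u (p k) * nsq (vel N p k))).
  rewrite (le_trans (ler_wpM2l (sqr_ge0 _) (ler_normD _ _)))// mulrDr -natr1 mulrDl mul1r addrC lerD ?IH ?(ltnW kM)//.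
  rewrite (le_trans _ (ler_norm C))// (le_trans _ h)// subr0.
  by rewrite /n /tN/= !normrM (ger0_norm (ltW N0)) [leRHS]mulrA -expr2.
move=> k kM; rewrite -(ler_pM2l N0) mulrA -expr2 (le_trans (st k kM))// ler_wpM2r//.
by rewrite ler_nat (leq_trans (ltnW kM))//; case/andP: dg.(dg_M).
Qed.


Let L0 N (p : nat -> R * R) : R := conf u (p 0%N) * nsq (vel N p 0%N).
Let L (t : T) : R := L0 (tN t) (tp t).

Lemma eqh_speed : eqh D n (fun t => a t * nsq (v t)) L /\ bdd D L.
Proof.
have [bv1 bv2 _ _] := bdd_vel; have [ba bai] := bdd_a.
have [C C0 HC] := speed_drift_chain.
have h : eqh D n (fun t => a t * nsq (v t)) L.
  exists C => t [dg /andP[_ kM]].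
  by rewrite normrM [X in X * _]ger0_norm ?ler0n//; apply: HC dg _ kM.
split=> //; apply: (bdd_eqh n1 (eqh_sym h)).
by rewrite /nsq; bdd_tac.
Qed.

Definition gradv N p k := grad_dot u (p k) (vel N p k).
Definition gradJv N p k :=
  dy u (p k) * (vel N p k).1 - dx u (p k) * (vel N p k).2.
Definition rotv N p k : R * R := (- (vel N p k).2, (vel N p k).1).

Definition jacobi_term N M p k : R :=
  let phi := profile R M k in
  let dphi := N%:R * (profile R M k.+1 - phi) in
  dphi ^+ 2 - (phi + profile R M k.+1) * dphi * gradv N p k
  + phi ^+ 2 * (hess u (p k) (rotv N p k) + gradv N p k ^+ 2 - gradJv N p k ^+ 2).

Definition parts_term N M p k : R :=
  let phi := profile R M k in
  let dphi := N%:R * (profile R M k.+1 - phi) in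
  dphi ^+ 2 + phi ^+ 2 * (N%:R * (gradv N p k - gradv N p k.-1)
  + hess u (p k) (rotv N p k) + gradv N p k ^+ 2 - gradJv N p k ^+ 2).

(** The boundary terms vanish because phi does at 0 and at M. *)
Lemma sum_jacobi_parts N M p :
  \sum_(k < M) jacobi_term N M p k = \sum_(k < M) parts_term N M p k.
Proof.
apply/eqP; rewrite -subr_eq0 -sumrB; apply/eqP.
have := @sum_by_parts R (fun k => profile R M k ^+ 2) (gradv N p) M.
rewrite profile0 profileM expr0n/= mul0r => /(_ erefl) /(congr1 (fun x => - (N%:R * x))).
rewrite mulr0 oppr0 mulr_sumr -sumrN => E'; rewrite -[RHS]E'.
apply: eq_bigr => k _; rewrite /jacobi_term /parts_term; ring.
Qed.

Definition normal_field N M p k : R * R :=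
  if (k < M)%N then (- (profile R M k * (vel N p k.-1).2),
                     profile R M k * (vel N p k.-1).1) else 0.

(** The cut-off at M agrees with the formula because phi vanishes there. *)
Lemma normal_fieldE N M p k : (k <= M)%N -> normal_field N M p k =
  (- (profile R M k * (vel N p k.-1).2), profile R M k * (vel N p k.-1).1).
Proof.
rewrite /normal_field leq_eqVlt => /orP[/eqP->|->//].
by rewrite ltnn profileM !mul0r oppr0.
Qed.

Lemma index_jacobi : exists2 C, 0 <= C & forall N M p,
  discrete_geodesic u S E d N M p -> forall k, (0 < k < M)%N ->
  N%:R * `|index_form u N p (normal_field N M p) k - L0 N p * jacobi_term N M p k| <= C
  /\ N%:R * `|parts_term N M p k - ((N%:R * (profile R M k.+1 - profile R M k)) ^+ 2
     + profile R M k ^+ 2 * (nsq (vel N p k) * laplacian u (p k)))| <= C.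
Proof.
have [bv1 bv2 bw1 bw2] := bdd_vel; have [ba bai] := bdd_a.
have sx := smooth_derive (1, 0) usmooth; have sy := smooth_derive (0, 1) usmooth.
have bgx := bdd_smooth sx; have bgy := bdd_smooth sy.
have bxx := bdd_smooth (smooth_derive (1, 0) sx).
have bxy := bdd_smooth (smooth_derive (0, 1) sx).
have byx := bdd_smooth (smooth_derive (1, 0) sy).
have byy := bdd_smooth (smooth_derive (0, 1) sy).
have bf : bdd D f by exists 1 => t _; exact: profile_max.
have bfd := bdd_fd.
have [eL bL] := eqh_speed.
have [C1 H1] := @second_variation_normal R T D n n1 a b
  (fun t => dx u (cur t)) (fun t => dy u (cur t))
  (fun t => dx (dx u) (cur t)) (fun t => dy (dx u) (cur t))
  (fun t => dx (dy u) (cur t)) (fun t => dy (dy u) (cur t))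
  (fun t => (v t).1) (fun t => (v t).2) (fun t => (w t).1) (fun t => (w t).2)
  f fd L a_neq0 ba bai bgx bgy bxx bxy byx byy bv1 bv2 bw1 bw2 bf bfd
  (fun t Dt => (Dt.1).(dg_euler1) Dt.2) (fun t Dt => (Dt.1).(dg_euler2) Dt.2)
  eqh_conf eL bL.
have [C2 H2] := @jacobi_by_parts R T D n n1 a b
  (fun t => dx u (cur t)) (fun t => dy u (cur t))
  (fun t => dx u (prv t)) (fun t => dy u (prv t))
  (fun t => dx (dx u) (cur t)) (fun t => dy (dx u) (cur t))
  (fun t => dx (dy u) (cur t)) (fun t => dy (dy u) (cur t))
  (fun t => (v t).1) (fun t => (v t).2) (fun t => (w t).1) (fun t => (w t).2)
  f fd a_neq0 ba bai bgx bgy bxx bxy byx byy bv1 bv2 bw1 bw2 bf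
  (fun t Dt => (Dt.1).(dg_euler1) Dt.2) (fun t Dt => (Dt.1).(dg_euler2) Dt.2)
  eqh_conf (eqh_taylor sx) (eqh_taylor sy).
exists (`|C1| + `|C2|) => [|N M p dg k kM]; first by rewrite addr_ge0.
have N0 : 0 < N%:R :> R by rewrite ltr0n dg.(dg_N).
have h1 := H1 (N, M, p, k) (conj dg kM).
have h2 := H2 (N, M, p, k) (conj dg kM).
split.
  apply: le_trans (le_trans h1 _); last first.
    by rewrite (le_trans (ler_norm _))// lerDl.
  rewrite normrM (ger0_norm (ltW N0)) le_eqVlt; apply/orP; left; apply/eqP.
  congr (_ * `|_ - _ * _|).
    case/andP: kM => k0 kM.
    (* Discrete Leibniz rule for phi J v. *)
    have d1E : (vel N (normal_field N M p) k).1 = - (fd (N, M, p, k) * (v (N, M, p, k)).2 +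
        f (N, M, p, k) * (n (N, M, p, k) * ((v (N, M, p, k)).2 - (w (N, M, p, k)).2))).
      rewrite [LHS](_ : _ = N%:R * ((normal_field N M p k.+1).1 - (normal_field N M p k).1))//.
      rewrite !normal_fieldE ?(ltnW kM)//= /fd /f /v /w /n /tN /tk /tM /tp/=.
      by ring.
    have d2E : (vel N (normal_field N M p) k).2 = fd (N, M, p, k) * (v (N, M, p, k)).1 +
        f (N, M, p, k) * (n (N, M, p, k) * ((v (N, M, p, k)).1 - (w (N, M, p, k)).1)).
      rewrite [LHS](_ : _ = N%:R * ((normal_field N M p k.+1).2 - (normal_field N M p k).2))//.
      rewrite !normal_fieldE ?(ltnW kM)//= /fd /f /v /w /n /tN /tk /tM /tp/=.
      by ring.
    have hE x y : hess u (p k) (x, y) = hess2 (fun t => dx (dx u) (cur t)) (fun t => dy (dx u) (cur t))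
        (fun t => dx (dy u) (cur t)) (fun t => dy (dy u) (cur t)) (N, M, p, k) x y.
      rewrite /hess /grad_dot /hess2 /cur /tp /tk/=.
      move: (dx (dx u) (p k)) (dy (dx u) (p k)) (dx (dy u) (p k)) (dy (dy u) (p k)) => xx xy yx yy.
      by ring.
    rewrite /index_form /dot /nsq d1E d2E normal_fieldE ?(ltnW kM)// hE.
    by [].
  rewrite /jacobi /jacobi_term /hess2 /hess /rotv /gv /gJv /gradv /gradJv /sqv.
  rewrite /grad_dot /a /cur /tp /tk /v /w /n /tN /f /fd /tM /=.
  move: (dx (dx u) (p k)) (dy (dx u) (p k)) (dx (dy u) (p k)) (dy (dy u) (p k)) => xx xy yx yy.
  move: (dx u (p k)) (dy u (p k)) => gx gy.
  move: (profile R M k) (profile R M k.+1) => f0 f1.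
  by field; rewrite gt_eqF.
apply: le_trans (le_trans h2 _); last first.
  by rewrite (le_trans (ler_norm _))// lerDr.
rewrite normrM (ger0_norm (ltW N0)) le_eqVlt; apply/orP; left; apply/eqP.
congr (_ * `|_ - _|).
rewrite /parts_term /hess2 /hess /rotv /gv /gJv /gradv /gradJv.
rewrite /grad_dot /laplacian -/(dx u) -/(dy u) -/(dx (dx u)) -/(dy (dy u)).
rewrite /sqv /nsq /a /cur /prv /tp /tk /v /w /n /tN /f /fd /tM /=.
move: (dx (dx u) (p k)) (dy (dx u) (p k)) (dx (dy u) (p k)) (dy (dy u) (p k)) => xx xy yx yy.
move: (dx u (p k)) (dy u (p k)) => gx gy.
move: (dx u (p k.-1)) (dy u (p k.-1)) => gx' gy'.
move: (profile R M k) (profile R M k.+1) => f0 f1.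
by ring.
Qed.

End length_bound.

Section length_bound2.
Variables (R : realType) (u : R * R -> R) (usmooth : smooth u).
Hypothesis ucurv : forall p : R * R, laplacian u p + expR (2 * u p) <= 0.
Variables (S E d : R).
Hypotheses (E0 : 0 < E) (d0 : 0 < d).
Let L0 N (p : nat -> R * R) : R := conf u (p 0%N) * nsq (vel N p 0%N).

(** The index 0, where the geodesic equation is not available, is treated by hand:
    phi vanishes there, and phi_1 is O(1/N). *)
Lemma start_bounds : exists2 B, 0 <= B & forall N M p,
  discrete_geodesic u S E d N M p -> L0 N p <= B /\
  N%:R * `|index_form u N p (normal_field N M p) 0 - L0 N p * jacobi_term u N M p 0| <= B.
Proof.
have [C C0 HC] := velocity_bound usmooth S E0 d0.
have [A A1 HA] := square_conf_bounds usmooth S.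
have [Gx Gx0 HGx] := square_bounded S (smooth_continuous (smooth_derive (1, 0) usmooth)).
have [Gy Gy0 HGy] := square_bounded S (smooth_continuous (smooth_derive (0, 1) usmooth)).
have A0 : 0 <= A by rewrite (le_trans ler01).
pose B := A * (C ^+ 2 + C ^+ 2).
have B0 : 0 <= B by rewrite mulr_ge0// addr_ge0// sqr_ge0.
pose K := B * ((C * pi) ^+ 2 * ((Gx + Gy) * (C + C))).
have K0 : 0 <= K by rewrite mulr_ge0// mulr_ge0 ?sqr_ge0// mulr_ge0// addr_ge0.
exists (B + K) => [|N M p dg]; first exact: addr_ge0.
have N0 : 0 < N%:R :> R by rewrite ltr0n dg.(dg_N).
have M0 : (0 < M)%N by case/andP: dg.(dg_M).
have [hN hv] := HC _ _ _ dg; have [v1 v2] := hv _ M0.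
have K00 : square S (p 0%N) by exact: dg.(dg_square).
have [hA _] := HA _ K00.
have LB : `|L0 N p| <= B.
  rewrite ger0_norm; last by rewrite mulr_ge0 ?nsq_ge0// ltW// conf_gt0.
  apply: ler_pM => //; rewrite ?nsq_ge0 ?(ltW (conf_gt0 _ _))//.
  by rewrite /nsq lerD// -real_normK ?num_real// lerXn2r// nnegrE.
split; first by rewrite (le_trans (ler_norm _))// (le_trans LB)// lerDl.
set fd := N%:R * (profile R M 1 - profile R M 0).
have -> : N%:R * `|index_form u N p (normal_field N M p) 0 - L0 N p * jacobi_term u N M p 0| =
   `|L0 N p| * (fd ^+ 2 * `|gradv u N p 0|).
  rewrite -[N%:R in LHS](ger0_norm (ltW N0)) -[fd ^+ 2]ger0_norm ?sqr_ge0// -!normrM; congr `|_|.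
  rewrite /index_form /vel !normal_fieldE//= /jacobi_term /fd profile0 /L0.
  rewrite /gradv /grad_dot /hess /nsq /dot /vel /=.
  move: (grad_dot (dx u) _ _) (grad_dot (dy u) _ _) (grad_dot (dx u) _ _) (grad_dot (dy u) _ _) => h1 h2 h3 h4.
  move: (dx u (p 0%N)) (dy u (p 0%N)) (profile R M 1) (conf u (p 0%N)) => gx gy f1 c.
  by ring.
apply: (@le_trans _ _ K); last by rewrite lerDr.
have fdC : `|fd| <= C * pi.
  rewrite /fd normrM ger0_norm ?ler0n//.
  rewrite (le_trans (ler_wpM2l (ler0n _ _) (profile_step R _ _)))//.
  by rewrite mulrCA mulrC ler_wpM2r ?pi_ge0// ler_pdivrMr// ltr0n.
have gC : `|gradv u N p 0| <= (Gx + Gy) * (C + C).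
  apply: le_trans (@grad_dot_le _ _ _ _ (Gx + Gy) _ _) _.
  - by rewrite (le_trans (HGx _ K00))// lerDl.
  - by rewrite (le_trans (HGy _ K00))// lerDr.
  - by rewrite ler_wpM2l ?addr_ge0// lerD.
apply: ler_pM => //; first by rewrite mulr_ge0 ?sqr_ge0.
apply: ler_pM => //; first exact: sqr_ge0.
by rewrite -real_normK ?num_real// lerXn2r// nnegrE// mulr_ge0// pi_ge0.
Qed.

(** Summing the index form of the normal field, the sums of phi'^2 and of phi^2 are
    N^2 (2 - 2 cos(pi / M)) M / 2 and M / 2.  The factor M / 2 is common to the
    main terms and to the error terms, so it can be divided out. *)
Lemma energy_gap : exists2 C, 0 <= C & forall N M p,
  discrete_geodesic u S E d N M p -> (1 < M)%N ->
  L0 N p * (L0 N p - (N%:R * (pi / M%:R)) ^+ 2) <= C / N%:R.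
Proof.
have [B B0 HB] := start_bounds.
have [C C0 HC] := index_jacobi usmooth S E0 d0.
have [C' C'0 HC'] := speed_drift_chain usmooth S E0 d0.
exists (2 * (B * (C + C')) + 2 * (B + C)) => [|N M p dg M1].
  by rewrite addr_ge0// mulr_ge0 ?mulr_ge0// addr_ge0.
have N0 : 0 < N%:R :> R by rewrite ltr0n dg.(dg_N).
have M0 : (0 < M)%N by exact: ltnW.
have [LB LB'] := HB _ _ _ dg; have L00 : 0 <= L0 N p.
  by rewrite mulr_ge0 ?nsq_ge0// ltW// conf_gt0.
pose fd k : R := N%:R * (profile R M k.+1 - profile R M k).
have step1 k : (k < M)%N -> index_form u N p (normal_field N M p) k <=
    L0 N p * jacobi_term u N M p k + (B + C) / N%:R.
  move=> kM; rewrite -lerBlDl ler_pdivlMr// mulrC (le_trans (ler_wpM2l (ltW N0) (ler_norm _)))//.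
  case: k kM => [|k] kM; first by rewrite (le_trans LB')// lerDl.
  by have [h _] := HC _ _ _ dg k.+1 kM; rewrite (le_trans h)// lerDr.
(* This is where the curvature enters: |v|^2 Delta u <= - |v|^2 e^{2u} = - L + O(1/N). *)
have step2 k : (k < M)%N -> parts_term u N M p k <=
    (fd k ^+ 2 - profile R M k ^+ 2 * L0 N p) + (C + C') / N%:R.
  case: k => [_|k kM].
    rewrite /parts_term /fd profile0 expr0n/= !mul0r !addr0 !subr0 lerDl.
    by rewrite divr_ge0 ?addr_ge0// ltW.
  have [_ h] := HC _ _ _ dg k.+1 kM; have h' := HC' _ _ _ dg k.+1 kM.
  set q := nsq (vel N p k.+1) in h h' *; set l := laplacian u _ in h.
  have lq : q * l <= - (conf u (p k.+1) * q).
    rewrite mulrC -mulNr ler_wpM2r ?nsq_ge0//.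
    by have := ucurv (p k.+1); rewrite -/l /conf; lra.
  have {}h' : - (conf u (p k.+1) * q) <= - L0 N p + C' / N%:R.
    rewrite -lerBlDl ler_pdivlMr// mulrC (le_trans _ h')// ler_wpM2l ?(ltW N0)//.
    by rewrite (le_trans (ler_norm _))// -normrN /L0 opprD !opprK addrC.
  have {}h : parts_term u N M p k.+1 <= fd k.+1 ^+ 2 + profile R M k.+1 ^+ 2 * (q * l) + C / N%:R.
    rewrite -lerBlDl ler_pdivlMr// mulrC (le_trans _ h)// ler_wpM2l ?(ltW N0)//.
    exact: ler_norm.
  apply: (le_trans h); rewrite [X in _ <= _ + X]mulrDl.
  have alg (F P Q L x y : R) : P * Q <= P * (- L) + P * y -> P * y <= y ->
    F + P * Q + x <= F - P * L + (x + y) by lra.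
  apply: alg.
    by rewrite -mulrDr ler_wpM2l ?sqr_ge0// (le_trans lq h').
  rewrite ler_piMl ?divr_ge0 ?(ltW N0)//.
  by rewrite -real_normK ?num_real// expr_le1// profile_max.
have ge0 : 0 <= \sum_(k < M) index_form u N p (normal_field N M p) k.
  apply: dg.(dg_index) => [|k Mk]; last by rewrite /normal_field ltnNge Mk.
  by rewrite normal_fieldE// profile0 !mul0r oppr0.
have sum1 : \sum_(k < M) index_form u N p (normal_field N M p) k <=
    L0 N p * \sum_(k < M) parts_term u N M p k + M%:R * ((B + C) / N%:R).
  rewrite -sum_jacobi_parts mulr_sumr mulr_natl -[X in _ *+ X](card_ord M) -sumr_const -big_split/=.
  by apply: ler_sum => k _; exact: step1.
have sum2 : \sum_(k < M) parts_term u N M p k <=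
    (N%:R * (pi / M%:R)) ^+ 2 * (M%:R / 2) - M%:R / 2 * L0 N p + M%:R * ((C + C') / N%:R).
  apply: (@le_trans _ _ (\sum_(k < M) ((fd k ^+ 2 - profile R M k ^+ 2 * L0 N p) + (C + C') / N%:R))).
    by apply: ler_sum => k _; exact: step2.
  rewrite big_split/= sumrB sumr_const card_ord -mulr_suml profile_norm// -[X in _ + X <= _]mulr_natl.
  rewrite lerD2r lerD2r /fd.
  under eq_bigr do rewrite exprMn.
  rewrite -mulr_sumr profile_dirichlet// profile_norm// exprMn mulrA.
  by rewrite ler_wpM2r ?divr_ge0// ler_wpM2l ?sqr_ge0// one_sub_cos_le.
set t := (N%:R * _) ^+ 2 in sum2 *.
have M0R : 0 < M%:R :> R by rewrite ltr0n.
have := le_trans ge0 (le_trans sum1 (lerD (ler_wpM2l L00 sum2) (lexx _))).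
set b := L0 N p in LB L00 *.
rewrite (_ : _ + _ = M%:R / 2 * (b * (t - b) + (2 * b * (C + C') + 2 * (B + C)) / N%:R)); last by field; rewrite gt_eqF.
rewrite pmulr_rge0 ?divr_gt0// => h.
have : (2 * b * (C + C') + 2 * (B + C)) / N%:R <= (2 * (B * (C + C')) + 2 * (B + C)) / N%:R.
  rewrite ler_wpM2r ?invr_ge0 ?(ltW N0)// lerD2r -mulrA ler_wpM2l// ler_wpM2r//.
  exact: addr_ge0.
lra.
Qed.

(** With tau = M / N <= 1, the length is at most tau sqrt(L + O(1/N)).  If L exceeds
    (pi / tau)^2 >= 4, then energy_gap can be divided by L and bounds the excess
    by O(1/N). *)
Lemma discrete_geodesic_length (eps : R) : 0 < eps ->
  exists N0 : nat, forall N M p, (N0 <= N)%N ->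
  discrete_geodesic u S E d N M p ->
  \sum_(k < M) expR (u (p k)) * euclidean_norm (p k.+1 - p k) <= pi + eps.
Proof.
move=> eps0.
have [C1 C10 H1] := energy_gap.
have [C2 C20 H2] := speed_drift_chain usmooth S E0 d0.
have [K K0 HK] := velocity_bound usmooth S E0 d0.
pose Q := C2 + K + (2 * C1 + C2) / eps + 1.
have Q1 : 1 <= Q.
  by rewrite /Q lerDr !addr_ge0// divr_ge0 ?addr_ge0 ?mulr_ge0// ltW.
exists (Num.truncn Q).+1 => N M p NQ dg.
have N0 : 0 < N%:R :> R by rewrite ltr0n dg.(dg_N).
have {}NQ : Q < N%:R.
  by rewrite (lt_le_trans (truncnS_gt Q))// ler_nat.
have /andP[M0 MN] := dg.(dg_M).
have M0R : 0 < M%:R :> R by rewrite ltr0n.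
have [NK _] := HK _ _ _ dg.
have e1 : 0 <= (2 * C1 + C2) / eps by rewrite divr_ge0 ?addr_ge0 ?mulr_ge0// ltW.
have M1 : (1 < M)%N.
  rewrite ltnNge; apply/negP => M1; have M1' : M%:R <= 1 :> R by rewrite lern1.
  by have := ler_wpM2l K0 M1'; move: NQ NK; rewrite /Q; lra.
have gap := H1 _ _ _ dg M1.
set l := L0 N p in gap.
pose tau : R := M%:R / N%:R.
have tau0 : 0 < tau by rewrite divr_gt0.
have tau1 : tau <= 1 by rewrite ler_pdivrMr// mul1r ler_nat.
pose Lam := l + C2 / N%:R.
have l0 : 0 <= l by rewrite mulr_ge0 ?nsq_ge0// ltW// conf_gt0.
have Lam0 : 0 <= Lam by rewrite addr_ge0// divr_ge0// ltW.
have len : \sum_(k < M) expR (u (p k)) * euclidean_norm (p k.+1 - p k) <= tau * Num.sqrt Lam.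
  rewrite /tau mulrAC -mulrA mulr_natl -[X in _ *+ X](card_ord M) -sumr_const.
  apply: ler_sum => k _.
  rewrite ler_pdivlMr// -(ger0_norm (x := _ * _ * N%:R)); last first.
    by rewrite !mulr_ge0 ?expR_ge0 ?sqrtr_ge0// ltW.
  rewrite -sqrtr_sqr ler_wsqrtr//.
  rewrite (_ : _ ^+ 2 = conf u (p k) * nsq (vel N p k)).
    rewrite /Lam -lerBlDl ler_pdivlMr// mulrC (le_trans (ler_wpM2l (ltW N0) (ler_norm _)))//.
    by apply: H2 dg _ _.
  rewrite !exprMn /euclidean_norm sqr_sqrtr ?addr_ge0 ?sqr_ge0//.
  by rewrite /conf mulr_natl mulr2n expRD /nsq/=; ring.
apply: (le_trans len).
have pe0 : 0 <= pi + eps by rewrite addr_ge0 ?pi_ge0// ltW.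
rewrite -(ger0_norm pe0) -(ger0_norm (mulr_ge0 (ltW tau0) (sqrtr_ge0 Lam))).
rewrite -!sqrtr_sqr ler_wsqrtr// exprMn sqr_sqrtr//.
have p2 := @pi_ge2 R.
have tauE : N%:R * (pi / M%:R) = pi / tau by rewrite /tau; field; rewrite !gt_eqF.
rewrite tauE in gap.
have h0 : (tau * (pi / tau)) ^+ 2 = pi ^+ 2 :> R by congr (_ ^+ 2); field; rewrite gt_eqF.
rewrite exprMn in h0.
have C2N : C2 / N%:R <= 1.
  by rewrite ler_pdivrMr// mul1r; apply: le_trans _ (ltW NQ); rewrite /Q; lra.
have CN : (2 * C1 + C2) / N%:R <= eps.
  rewrite ler_pdivrMr// [eps * _]mulrC -ler_pdivrMr//; apply: le_trans _ (ltW NQ); rewrite /Q; lra.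
have tau21 : tau ^+ 2 <= 1 by rewrite expr_le1// ltW.
have tau20 : 0 <= tau ^+ 2 := sqr_ge0 _.
have pes : pi ^+ 2 + eps <= (pi + eps) ^+ 2.
  have := sqr_ge0 eps; have := ler_wpM2r (ltW eps0) p2; lra.
set z := (pi / tau) ^+ 2 in gap h0.
have z4 : 4 <= z.
  have : 4 <= pi ^+ 2 :> R by have := ler_pM (ler0n R 2) (ler0n R 2) p2 p2; lra.
  have zz : 0 <= z := sqr_ge0 _.
  have := ler_piMl zz tau21; lra.
have [lz|zl] := leP l z.
  have h1 : tau ^+ 2 * Lam <= tau ^+ 2 * (z + C2 / N%:R) by rewrite ler_wpM2l// lerD2r.
  have h2 := ler_piMl (divr_ge0 C20 (ltW N0)) tau21.
  have h3 : 0 <= 2 * C1 / N%:R by rewrite divr_ge0 ?mulr_ge0// ltW.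
  lra.
have gap' : l - z <= C1 / N%:R.
  apply: le_trans gap; rewrite ler_peMl ?subr_ge0 ?(ltW zl)//; lra.
have h1 : tau ^+ 2 * Lam <= tau ^+ 2 * (z + (C1 + C2) / N%:R).
  by rewrite ler_wpM2l// /Lam mulrDl; lra.
have h2 := ler_piMl (divr_ge0 (addr_ge0 C10 C20) (ltW N0)) tau21.
have h3 : 0 <= C1 / N%:R by rewrite divr_ge0 // ltW.
lra.
Qed.

End length_bound2.

(** * First and second variation of the energy of a chain *)

Section local_minimum.
Variable R : realType.

(** If the second derivative were negative, the derivative would be negative just to
    the right of 0, contradicting the mean value theorem. *)
Lemma second_derivative_test (F F1 : R -> R) (F2 r : R) : 0 < r ->
  (forall s : R, is_derive s 1 F (F1 s)) -> is_derive (0 : R) 1 F1 F2 ->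
  (forall s, `|s| < r -> F 0 <= F s) -> F1 0 = 0 /\ 0 <= F2.
Proof.
move=> r0 dF dF1 Fmin.
have F10 : F1 0 = 0.
  have h : is_derive (0 : R) 1 F 0.
    apply: (@derive1_at_min _ _ (- r) r).
    - by rewrite ltW// gt0_cp.
    - by move=> t _; case: (dF t).
    - by rewrite in_itv/= oppr_lt0 r0.
    - by move=> t; rewrite in_itv/= -ltr_norml; exact: Fmin.
  by case: (dF 0) => _ <-; case: h => _ ->.
split=> //; rewrite leNgt; apply/negP => F2lt.
have cv : (fun h => h^-1 *: (F1 (h *: 1 + 0) - F1 0)) @ 0^' --> F2.
  by case: dF1 => dv <-; exact: dv.
have : \forall h \near 0^', h^-1 *: (F1 (h *: 1 + 0) - F1 0) < 0.
  exact: (cvgr_lt _ cv).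
rewrite near_withinE => /nbhs_ballP[e /= e0 He].
pose s := Num.min e r / 2.
have s0 : 0 < s by rewrite divr_gt0// lt_min e0.
have se : s < e.
  by rewrite ltr_pdivrMr// (le_lt_trans (y := e * 1)) ?mulr1 ?ge_min ?lexx// ltr_pMr// ltr1n.
have sr : s < r.
  by rewrite ltr_pdivrMr// (le_lt_trans (y := r * 1)) ?mulr1 ?ge_min ?lexx ?orbT// ltr_pMr// ltr1n.
have neg c : 0 < c <= s -> F1 c < 0.
  move=> /andP[c0 cs]; have := He c.
  rewrite /ball/= sub0r normrN gtr0_norm// => /(_ (le_lt_trans cs se)) /(_ (lt0r_neq0 c0)).
  rewrite F10 subr0 addr0 (_ : c *: (1 : R) = c); last exact: mulr1.
  by rewrite /GRing.scale/= pmulr_rlt0// invr_gt0.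
have cF : {within `[0, s], continuous F}.
  apply: continuous_subspaceT => x; apply: differentiable_continuous.
  by apply/derivable1_diffP; case: (dF x).
have [c c0s E] := MVT s0 (fun x _ => dF x) cF.
have := Fmin s; rewrite gtr0_norm// => /(_ sr).
rewrite -subr_ge0 E subr0 => h.
have : F1 c < 0.
  by apply: neg; move: c0s; rewrite in_itv/= => /andP[-> /ltW->].
rewrite -(pmulr_llt0 _ s0) => h'.
by have := lt_le_trans h' h; rewrite ltxx.
Qed.

End local_minimum.

Section variation.
Variables (R : realType) (u : R * R -> R) (usmooth : smooth u).
Implicit Types (p xi : nat -> R * R) (N M k : nat).

Definition step p k : R * R := p k.+1 - p k.
Definition line p xi (s : R) k : R * R := p k + s *: xi k.
Definition cell p k : R := conf u (p k) * nsq (step p k).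

(** cell1 and cell2 are the first and second derivatives of cell along the variation
    p + s xi, the latter at s = 0 only. *)
Definition cell1 p xi s k : R := conf u (line p xi s k) *
  (2 * grad_dot u (line p xi s k) (xi k) * nsq (step (line p xi s) k)
   + 2 * dot (step (line p xi s) k) (step xi k)).

Lemma is_derive_conf_line p xi k (s : R) :
  is_derive s 1 (fun s => conf u (line p xi s k))
    (2 * grad_dot u (line p xi s k) (xi k) * conf u (line p xi s k)).
Proof.
have h := is_derive_line (p k) (xi k) s usmooth.
have h2 : is_derive s 1 (fun s => 2 * u (line p xi s k)) (2 * grad_dot u (line p xi s k) (xi k)).
  exact: is_deriveZ.
have := @is_derive1_comp R expR (fun s => 2 * u (line p xi s k)) s _ _ (is_derive_expR _) h2.
by rewrite mulrC.
Qed.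

Lemma stepE p xi s k : step (line p xi s) k = step p k + s *: step xi k.
Proof. by rewrite /step /line scalerBr opprD addrACA. Qed.

Lemma is_derive_affine (a b s : R) : is_derive s 1 (fun s => a + s * b) b.
Proof.
have h := is_deriveD (is_derive_cst a s 1) (is_deriveZ b (is_derive_id s (1 : R))).
have -> : (fun s : R => a + s * b) = cst a + b \*: (id : R -> R).
  by apply/funext => x /=; rewrite [RHS]/(a + b * x) mulrC.
by apply: is_derive_eq h _; rewrite /GRing.scale/= mulr1 add0r.
Qed.

Lemma is_derive_nsq_line (a b : R * R) (s : R) :
  is_derive s 1 (fun s => nsq (a + s *: b)) (2 * dot (a + s *: b) b).
Proof.
have h1 := is_derive_affine a.1 b.1 s; have h2 := is_derive_affine a.2 b.2 s.
have h := is_deriveD (is_deriveM h1 h1) (is_deriveM h2 h2).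
have -> : (fun s => nsq (a + s *: b)) =
   (fun s => a.1 + s * b.1) * (fun s => a.1 + s * b.1) + (fun s => a.2 + s * b.2) * (fun s => a.2 + s * b.2).
  by apply/funext => x; rewrite /nsq/= !expr2.
by apply: is_derive_eq h _; rewrite /dot /GRing.scale/= /GRing.scale/=; ring.
Qed.

Lemma is_derive_dot_line (a b : R * R) (s : R) :
  is_derive s 1 (fun s => dot (a + s *: b) b) (nsq b).
Proof.
have h1 := is_derive_affine a.1 b.1 s; have h2 := is_derive_affine a.2 b.2 s.
have h := is_deriveD (is_deriveZ b.1 h1) (is_deriveZ b.2 h2).
have -> : (fun s => dot (a + s *: b) b) =
   b.1 \*: (fun s => a.1 + s * b.1) + b.2 \*: (fun s => a.2 + s * b.2).
  have E x : dot (a + x *: b) b = b.1 * (a.1 + x * b.1) + b.2 * (a.2 + x * b.2).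
    by rewrite /dot/= /GRing.scale/=; ring.
  by apply/funext => x; exact: E.
by apply: is_derive_eq h _; rewrite /nsq /GRing.scale/= !expr2.
Qed.

Lemma is_derive_grad_line (a b : R * R) (s : R) :
  is_derive s 1 (fun s => grad_dot u (a + s *: b) b) (hess u (a + s *: b) b).
Proof.
have h1 := is_derive_line a b s (smooth_derive (1, 0) usmooth).
have h2 := is_derive_line a b s (smooth_derive (0, 1) usmooth).
have h := is_deriveD (is_deriveZ b.1 h1) (is_deriveZ b.2 h2).
have -> : (fun s => grad_dot u (a + s *: b) b) =
   b.1 \*: (fun s => dx u (a + s *: b)) + b.2 \*: (fun s => dy u (a + s *: b)).
  have E x : grad_dot u (a + x *: b) b = b.1 * dx u (a + x *: b) + b.2 * dy u (a + x *: b).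
    by rewrite /grad_dot mulrC [X in _ + X]mulrC.
  by apply/funext => x; exact: E.
by apply: is_derive_eq h _; rewrite /hess /GRing.scale/= mulrC [X in _ + X]mulrC.
Qed.

Lemma is_derive_cell p xi k (s : R) :
  is_derive s 1 (fun s => cell (line p xi s) k) (cell1 p xi s k).
Proof.
have h1 := is_derive_conf_line p xi k s.
have h2 := is_derive_nsq_line (step p k) (step xi k) s.
have -> : (fun s => cell (line p xi s) k) =
   (fun s => conf u (line p xi s k)) * (fun s => nsq (step p k + s *: step xi k)).
  by apply/funext => x; rewrite /cell stepE.
apply: is_derive_eq (is_deriveM h1 h2) _.
rewrite /cell1 stepE /GRing.scale/=.
move: (conf _ _) (grad_dot _ _ _) (nsq _) (dot _ _) => c g x y.
by ring.
Qed.

Definition cell2 p xi k : R := conf u (p k) *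
  ((4 * grad_dot u (p k) (xi k) ^+ 2 + 2 * hess u (p k) (xi k)) * nsq (step p k)
   + 8 * grad_dot u (p k) (xi k) * dot (step p k) (step xi k)
   + 2 * nsq (step xi k)).

Lemma line0 p xi k : line p xi 0 k = p k.
Proof. by rewrite /line scale0r addr0. Qed.

Lemma is_derive_cell1 p xi k :
  is_derive (0 : R) 1 (fun s => cell1 p xi s k) (cell2 p xi k).
Proof.
have h1 := is_derive_conf_line p xi k 0.
have h2 := is_derive_nsq_line (step p k) (step xi k) 0.
have h3 := is_derive_dot_line (step p k) (step xi k) 0.
have h4 := is_derive_grad_line (p k) (xi k) 0.
pose G (s : R) := 2 * (grad_dot u (p k + s *: xi k) (xi k)
  * nsq (step p k + s *: step xi k)) + 2 * dot (step p k + s *: step xi k) (step xi k).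
have hG := is_deriveD (is_deriveZ 2 (is_deriveM h4 h2)) (is_deriveZ 2 h3).
rewrite -[(_ + _ : R -> R)]/G in hG.
have -> : (fun s => cell1 p xi s k) = (fun s => conf u (line p xi s k)) * G.
  have E x : cell1 p xi x k = conf u (line p xi x k) * G x.
    by rewrite /cell1 stepE /G [2 * (_ * _)]mulrA.
  by apply/funext => x; exact: E.
apply: is_derive_eq (is_deriveM h1 hG) _.
rewrite /cell2 line0 /G /= !scale0r !addr0 /GRing.scale/=.
move: (conf _ _) (grad_dot _ _ _) (nsq _) (nsq _) (dot _ _) (hess _ _ _) => c g x x' y h.
by ring.
Qed.

Lemma is_derive_sum_cells M (F : R -> nat -> R) (dF : nat -> R) (s : R) :
  (forall k, is_derive s 1 (fun s => F s k) (dF k)) ->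
  is_derive s 1 (fun s => \sum_(k < M) F s k) (\sum_(k < M) dF k).
Proof.
move=> h.
have -> : (fun s => \sum_(k < M) F s k) = \sum_(k < M) (fun s => F s k).
  by apply/funext => x; rewrite fct_sumE.
by apply: is_derive_sum => i; exact: h.
Qed.

Lemma cells_minimal p xi M (r : R) : 0 < r ->
  (forall s, `|s| < r -> \sum_(k < M) cell p k <= \sum_(k < M) cell (line p xi s) k) ->
  \sum_(k < M) cell1 p xi 0 k = 0 /\ 0 <= \sum_(k < M) cell2 p xi k.
Proof.
move=> r0 pmin.
have dF (s : R) := is_derive_sum_cells M (fun k => is_derive_cell p xi k s).
have dF1 := is_derive_sum_cells M (is_derive_cell1 p xi).
apply: (second_derivative_test r0 dF dF1) => s /pmin.
rewrite (eq_bigr (fun k : 'I_M => cell (line p xi 0) k))// => k _.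
by rewrite /cell /step !line0.
Qed.

Lemma index_formE N p xi k : index_form u N p xi k = N%:R ^+ 2 / 2 * cell2 p xi k.
Proof.
rewrite /index_form /cell2 /nsq /dot /vel /step/=.
move: (conf _ _) (grad_dot _ _ _) (hess _ _ _) => c g h.
by field.
Qed.

End variation.

(** * Existence of discrete geodesics *)

Section existence.
Variables (R : realType) (u : R * R -> R) (usmooth : smooth u).
Variables (S : R) (x : R * R).
Hypotheses (x1 : `|x.1| < S) (x2 : `|x.2| < S).
Implicit Types (p xi : nat -> R * R) (N M k : nat).

(** Meaningful for points of the square of size S. *)
Definition on_boundary (q : R * R) : bool := (`|q.1| == S) || (`|q.2| == S).

Let corner : R * R := (S, S).

Let S0 : 0 < S. Proof. exact: le_lt_trans x1. Qed.

Definition admissible N p :=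
  [/\ p 0%N = x, p N = corner & forall k, square S (p k)].

Definition energy N p : R := \sum_(k < N) cell u p k.

Let square_x : square S x. Proof. by split; exact: ltW. Qed.
Let square_corner : square S corner.
Proof. by split; rewrite /= ger0_norm// ltW. Qed.

Definition straight N k : R * R := if (k < N)%N then x + (k%:R / N%:R) *: (corner - x) else corner.

Lemma straight_admissible N : (0 < N)%N -> admissible N (straight N).
Proof.
move=> N0; split; rewrite /straight ?N0 ?ltnn//; first by rewrite mul0r scale0r addr0.
move=> k; case: ifP => // kN; apply: square_segment => //.
by rewrite divr_ge0//= ler_pdivrMr ?ltr0n// mul1r ler_nat ltnW.
Qed.

(** Continuity is for pointwise convergence of sequences, for which the set of
    admissible chains is compact by the theorem of Tychonoff. *)
Lemma energy_continuous N : continuous (energy N : prod_topology (fun _ : nat => (R * R)%type) -> R).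
Proof.
have cp k : continuous (fun p : prod_topology (fun _ : nat => (R * R)%type) => p k).
  exact: (@proj_continuous _ (fun _ : nat => (R * R)%type) k).
have c1 k : continuous (fun p : prod_topology (fun _ : nat => (R * R)%type) => (p k).1).
  by move=> p; apply: cvg_comp (cp k p) _; exact: cvg_fst.
have c2 k : continuous (fun p : prod_topology (fun _ : nat => (R * R)%type) => (p k).2).
  by move=> p; apply: cvg_comp (cp k p) _; exact: cvg_snd.
have cc k : continuous (fun p : prod_topology (fun _ : nat => (R * R)%type) => conf u (p k)).
  move=> p; apply: (@continuous_comp _ _ _ (fun p : prod_topology (fun _ : nat => (R * R)%type) => 2 * u (p k)) expR).
    have h := continuous_comp (cp k p) (@smooth_continuous _ _ usmooth _).
    exact: cvgM (@cvg_cst _ _ _ _ _) h.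
  exact: continuous_expR.
have cell_c k : continuous (fun p : prod_topology (fun _ : nat => (R * R)%type) => cell u p k).
  rewrite (_ : (fun p => _) = fun p : nat -> R * R => conf u (p k) *
     (((p k.+1).1 - (p k).1) * ((p k.+1).1 - (p k).1) +
      ((p k.+1).2 - (p k).2) * ((p k.+1).2 - (p k).2))); last first.
    by apply/funext => p; rewrite /cell /nsq /step/= !expr2.
  move=> p.
  have d1 := cvgB (c1 k.+1 p) (c1 k p); have d2 := cvgB (c2 k.+1 p) (c2 k p).
  exact: (cvgM (cc k p) (cvgD (cvgM (d1 _) (d1 _)) (cvgM (d2 _) (d2 _)))).
elim: N => [|N IH].
  rewrite (_ : energy 0 = fun=> 0); first exact: cst_continuous.
  by apply/funext => q; rewrite /energy big_ord0.
rewrite (_ : energy N.+1 = fun q : nat -> R * R => energy N q + cell u q N).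
  by move=> p; exact: cvgD (IH p) (cell_c N p).
by apply/funext => q; rewrite /energy big_ord_recr.
Qed.

Lemma minimizer_exists N : (0 < N)%N -> exists2 p, admissible N p &
  forall p', admissible N p' -> energy N p <= energy N p'.
Proof.
move=> N0.
pose A k : set (R * R) := if k == 0%N then [set x] else if k == N then [set corner] else square S.
have cA k : compact (A k).
  by rewrite /A; case: ifP => _; [|case: ifP => _]; [exact: compact_set1|exact: compact_set1|exact: square_compact].
have AP p : (forall k, A k (p k)) <-> admissible N p.
  split=> [H|[p0 pN pk] k].
    split; first by have := H 0%N.
      by have := H N; rewrite /A eqxx gtn_eqF.
    move=> k; have := H k; rewrite /A; case: ifP => _; first by move=> ->.
    by case: ifP => _ // ->.
  by rewrite /A; case: eqP => [->//|_]; case: eqP => [->//|_].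
pose K : set (prod_topology (fun _ : nat => (R * R)%type)) := [set f | forall i, A i (f i)].
have tA : compact K := @tychonoff _ (fun _ : nat => (R * R)%type) A cA.
have nA : K !=set0 by exists (straight N); apply/AP; exact: straight_admissible.
have cE : {within K, continuous (energy N)}.
  exact: (continuous_subspaceT (@energy_continuous N)).
have [p pA pmin] := compact_EVT_min nA tA cE.
exists p; first by apply/AP; move: pA; rewrite inE.
by move=> p' /AP p'A; apply: pmin; rewrite inE.
Qed.

Lemma interior_stable (a b : R) : `|a| < S ->
  exists2 r, 0 < r & forall s, `|s| < r -> `|a + s * b| <= S.
Proof.
move=> aS; have b0 : 0 < `|b| + 1 by rewrite ltr_wpDl.
exists ((S - `|a|) / (`|b| + 1)) => [|s]; first by rewrite divr_gt0 ?subr_gt0.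
rewrite ltr_pdivlMr// => h.
rewrite (le_trans (ler_normD _ _))// normrM addrC -lerBrDr (le_trans _ (ltW h))//.
by rewrite ler_wpM2l// lerDl.
Qed.

(** Before the index M the chain stays in the open square, so it can be moved freely
    there. *)
Lemma perturbation_admissible N M p xi : admissible N p ->
  (0 < M <= N)%N -> (forall k, (k < M)%N -> ~~ on_boundary (p k)) ->
  xi 0%N = 0 -> (forall k, (M <= k)%N -> xi k = 0) ->
  exists2 r, 0 < r & forall s, `|s| < r -> admissible N (line p xi s).
Proof.
move=> [p0 pN pk] /andP[M0 MN] int xi0 xiM.
have [r r0 H] : exists2 r, 0 < r & forall s, `|s| < r -> forall k, (k < M)%N -> square S (line p xi s k).
  elim: (M) int => [_|j IH int]; first by exists 1.
  have [|r r0 H] := IH; first by move=> k kj; apply: int; exact: ltnW.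
  have := int j (ltnSn j); rewrite negb_or => /andP[n1 n2].
  have [h1 h2] := pk j.
  have [|r1 r10 H1] := @interior_stable (p j).1 (xi j).1; first by rewrite lt_neqAle n1.
  have [|r2 r20 H2] := @interior_stable (p j).2 (xi j).2; first by rewrite lt_neqAle n2.
  exists (Num.min r (Num.min r1 r2)) => [|s]; first by rewrite !lt_min r0 r10.
  rewrite !lt_min => /and3P[sr s1 s2] k; rewrite ltnS leq_eqVlt => /orP[/eqP->|]; last exact: H.
  by split; [exact: H1|exact: H2].
exists r => // s sr; split.
- by rewrite /line xi0 scaler0 addr0.
- by rewrite /line xiM// scaler0 addr0.
- move=> k; have [kM|Mk] := ltnP k M; first exact: H.
  by rewrite /line xiM// scaler0 addr0.
Qed.

Lemma minimizer_stationary N M p xi : admissible N p ->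
  (forall p', admissible N p' -> energy N p <= energy N p') ->
  (0 < M <= N)%N -> (forall k, (k < M)%N -> ~~ on_boundary (p k)) ->
  xi 0%N = 0 -> (forall k, (M <= k)%N -> xi k = 0) ->
  \sum_(k < M) cell1 u p xi 0 k = 0 /\ 0 <= \sum_(k < M) cell2 u p xi k.
Proof.
move=> pA pmin MN int xi0 xiM.
have [r r0 H] := perturbation_admissible pA MN int xi0 xiM.
apply: (cells_minimal usmooth r0) => s /H/pmin.
case/andP: MN => _ MN.
rewrite /energy -!(big_mkord xpredT) !(@big_cat_nat _ _ _ M 0%N N)//=.
rewrite [X in _ + X <= _](@eq_big_nat _ _ _ _ _ _ (cell u (line p xi s))) ?lerD2r// => k /andP[Mk _].
by rewrite /cell /step /line !xiM// ?(leq_trans Mk)// !scaler0 !addr0.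
Qed.

Lemma sum_two (F : nat -> R) M i : (0 < i < M)%N ->
  (forall k, k != i -> k != i.-1 -> F k = 0) ->
  \sum_(k < M) F k = F i.-1 + F i.
Proof.
move=> /andP[i0 iM] HF.
have iM' : (i.-1 < M)%N by rewrite (leq_ltn_trans (leq_pred _)).
rewrite (bigD1 (Ordinal iM'))//= (bigD1 (Ordinal iM))/=; last first.
  by rewrite -val_eqE/= neq_ltn orbC ltn_predL i0.
rewrite big1 ?addr0// => k /andP[k1 k2].
by apply: HF; [move: k2|move: k1]; rewrite -val_eqE.
Qed.

(** First variation with respect to the single point p_i, which only affects the
    steps i - 1 and i. *)
Lemma minimizer_euler N M p (e : R * R) i : admissible N p ->
  (forall p', admissible N p' -> energy N p <= energy N p') ->
  (0 < M <= N)%N -> (forall k, (k < M)%N -> ~~ on_boundary (p k)) -> (0 < i < M)%N ->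
  conf u (p i) * (dot (step p i) e - grad_dot u (p i) e * nsq (step p i)) =
  conf u (p i.-1) * dot (step p i.-1) e.
Proof.
move=> pA pmin MN int iM; case/andP: (iM) => i0 iM'.
pose xi k : R * R := if k == i then e else 0.
have xi0 : xi 0%N = 0 by rewrite /xi ltn_eqF.
have xiM k : (M <= k)%N -> xi k = 0 by move=> Mk; rewrite /xi gtn_eqF// (leq_trans iM').
have [+ _] := minimizer_stationary pA pmin MN int xi0 xiM.
have l0 k : line p xi 0 k = p k by exact: line0.
have s0 k : step (line p xi 0) k = step p k by rewrite /step !l0.
rewrite (@sum_two _ _ i)//; last first.
  move=> k ki ki'.
  have ki1 : (k.+1 == i) = false.
    by apply/negbTE; apply: contra ki' => /eqP <-.
  have xk : xi k = 0 by rewrite /xi (negbTE ki).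
  have sk : step xi k = 0 by rewrite /step xk /xi ki1 subrr.
  by rewrite /cell1 xk sk /dot /grad_dot/= !mulr0 !addr0 !(mulr0, mul0r) addr0 mulr0.
rewrite /cell1 !s0 !l0.
have -> : step xi i.-1 = e.
  by rewrite /step /xi prednK// eqxx ltn_eqF ?ltn_predL// subr0.
have -> : step xi i = - e.
  by rewrite /step /xi eqxx gtn_eqF// sub0r.
have -> : xi i.-1 = 0 by rewrite /xi ltn_eqF ?ltn_predL.
have -> : xi i = e by rewrite /xi eqxx.
have -> : grad_dot u (p i.-1) 0 = 0 by rewrite /grad_dot/= !mulr0 addr0.
have -> : dot (step p i) (- e) = - dot (step p i) e by rewrite /dot/= !mulrN opprD.
move: (conf _ _) (conf _ _) (grad_dot _ _ _) (nsq _) (nsq _) (dot _ _) (dot _ _) => c c' g q q' a b.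
lra.
Qed.

(** E comes from the chain of N equal steps on the straight segment to the corner,
    and d is the distance from x to the boundary of the square. *)
Lemma discrete_geodesic_exists : exists E d : R, [/\ 0 < E, 0 < d &
  forall N, (0 < N)%N -> exists M p, [/\ discrete_geodesic u S E d N M p,
    p 0%N = x & on_boundary (p M)]].
Proof.
have [A A1 HA] := square_conf_bounds usmooth S.
have A0 : 0 <= A by rewrite (le_trans ler01).
pose E := A * nsq (corner - x) + 1; pose d := Num.min (S - `|x.1|) (S - `|x.2|).
exists E, d; split.
- by rewrite ltr_wpDl// mulr_ge0// nsq_ge0.
- by rewrite lt_min !subr_gt0 x1.
move=> N N0; have N0R : 0 < N%:R :> R by rewrite ltr0n.
have [p pA pmin] := minimizer_exists N0.
have [p0 pN pk] := pA.
have bN : exists k, on_boundary (p k).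
  by exists N; rewrite pN /on_boundary/= ger0_norm ?eqxx// ltW.
case: (ex_minnP bN) => M bM Mmin.
have M0 : (0 < M)%N.
  by rewrite lt0n; apply/eqP => M0; move: bM; rewrite M0 p0 /on_boundary !lt_eqF.
have MN : (M <= N)%N by apply: Mmin; rewrite pN /on_boundary/= ger0_norm ?eqxx// ltW.
have int k : (k < M)%N -> ~~ on_boundary (p k).
  by move=> kM; apply/negP => /Mmin; rewrite leqNgt kM.
have MNb : (0 < M <= N)%N by rewrite M0.
have velE k : vel N p k = N%:R *: step p k by [].
have nv k : nsq (vel N p k) = N%:R ^+ 2 * nsq (step p k).
  by rewrite velE /nsq/= /GRing.scale/=; ring.
have EL e i (iM : (0 < i < M)%N) := minimizer_euler e pA pmin MNb int iM.
exists M, p; split=> //; split=> //.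
- rewrite (eq_bigr (fun k : 'I_M => N%:R ^+ 2 * cell u p k)); last first.
    by move=> k _; rewrite nv /cell mulrCA.
  rewrite -mulr_sumr.
  have h1 : \sum_(k < M) cell u p k <= energy N (straight N).
    apply: le_trans (pmin _ (straight_admissible N0)).
    rewrite /energy -!(big_mkord xpredT) (@big_cat_nat _ _ _ M 0%N N)//= lerDl.
    by apply: sumr_ge0 => k _; rewrite mulr_ge0 ?nsq_ge0// ltW// conf_gt0.
  have h2 : energy N (straight N) <= N%:R * (A * nsq (corner - x) / N%:R ^+ 2).
    rewrite mulr_natl -[X in _ *+ X](card_ord N) -sumr_const.
    apply: ler_sum => k _; rewrite -mulrA; apply: ler_pM.
    - by rewrite ltW// conf_gt0.
    - exact: nsq_ge0.
    - by have [_ _ /(_ k)/HA[]] := straight_admissible N0.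
    have -> : step (straight N) k = N%:R^-1 *: (corner - x).
      rewrite /step /straight ltn_ord; case: ifP => kN.
        by rewrite opprD addrACA subrr add0r -scalerBl -mulrBl -natrB// subSnn mul1r.
      have -> : k = N.-1 :> nat.
        by apply/eqP; rewrite -eqSS prednK// eqn_leq ltn_ord leqNgt kN.
      rewrite opprD addrA -[X in X - _]scale1r -scalerBl; congr (_ *: _).
      have n1 : N%:R = N.-1%:R + 1 :> R by rewrite natr1 prednK.
      have nn : N%:R != 0 :> R by rewrite gt_eqF.
      by apply: (mulIf nn); rewrite mulrBl mul1r divfK// mulVf// n1; ring.
    rewrite le_eqVlt; apply/orP; left; apply/eqP.
    by rewrite /nsq/= /GRing.scale/=; field; rewrite gt_eqF.
  have n0 : N%:R != 0 :> R by rewrite gt_eqF.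
  apply: le_trans (ler_wpM2l (sqr_ge0 _) (le_trans h1 h2)) _.
  have -> : N%:R ^+ 2 * (N%:R * (A * nsq (corner - x) / N%:R ^+ 2)) = A * nsq (corner - x) * N%:R.
    by move: (nsq _) => q; field.
  by rewrite ler_wpM2r ?(ltW N0R)// /E lerDl.
- move=> k kM; have := EL (1, 0) k kM; rewrite nv !velE/= /GRing.scale/=.
  rewrite /grad_dot/dot/= !mulr0 !addr0 !mulr1 => /(congr1 ( *%R N%:R)) h.
  rewrite [RHS]mulrCA -h.
  move: (conf _ _) (dx _ _) (nsq _) => c g q; by field; rewrite gt_eqF.
- move=> k kM; have := EL (0, 1) k kM; rewrite nv !velE/= /GRing.scale/=.
  rewrite /grad_dot/dot/= !mulr0 !add0r !mulr1 => /(congr1 ( *%R N%:R)) h.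
  rewrite [RHS]mulrCA -h.
  move: (conf _ _) (dy _ _) (nsq _) => c g q; by field; rewrite gt_eqF.
- move=> xi xi0 xiM.
  have [_ h] := minimizer_stationary pA pmin MNb int xi0 xiM.
  under eq_bigr do rewrite index_formE.
  by rewrite -mulr_sumr mulr_ge0// divr_ge0// sqr_ge0.
- rewrite p0 /l1/= /d ge_min; move: bM => /orP[/eqP h|/eqP h]; apply/orP; [left|right].
    by rewrite -h (le_trans (lerB_dist _ _))// lerDl.
  by rewrite -h (le_trans (lerB_dist _ _))// lerDr.
Qed.

End existence.

(** * Curves built from straight segments *)

Section two_pieces.
Variable R : realType.
Local Notation mu := (@lebesgue_measure R).

(** Changing an integrand at the single point b affects neither measurability nor
    the integral; at that point the speed of a broken line is not controlled. *)
Lemma measurable_integral_two_pieces (a b c : R) (F G H : R -> R) :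
  a < b -> b < c -> (forall t, 0 <= F t) ->
  measurable_fun `]a, b[ G -> measurable_fun `]b, c[ H ->
  {in `]a, b[, G =1 F} -> {in `]b, c[, H =1 F} ->
  measurable_fun `]a, c[ F /\
  (\int[mu]_(t in `]a, c[) (F t)%:E =
   \int[mu]_(t in `]a, b[) (G t)%:E + \int[mu]_(t in `]b, c[) (H t)%:E)%E.
Proof.
move=> ab bc F0 mG mH GF HF.
have ml : measurable_fun `]a, b[ F.
  by apply: eq_measurable_fun mG => t; rewrite inE; exact: GF.
have mr : measurable_fun `]b, c[ F.
  by apply: eq_measurable_fun mH => t; rewrite inE; exact: HF.
have U : `]a, c[%classic = `]a, b]%classic `|` `]b, c[%classic :> set R.
  by rewrite -itv_bndbnd_setU// bnd_simp ltW.
have mab : measurable (`]a, b]%classic : set R) by exact: measurable_itv.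
have mbc : measurable (`]b, c[%classic : set R) by exact: measurable_itv.
have ml' : measurable_fun `]a, b] F by exact/measurable_fun_itv_bndo_bndcP.
have mU : measurable_fun (`]a, b]%classic `|` `]b, c[%classic) F.
  exact: (measurable_funU _ mab mbc).2 (conj ml' mr).
split; first by rewrite U.
rewrite U ge0_integral_setU//=.
- rewrite integral_itv_bndoo; last exact/measurable_EFinP.
  congr (_ + _)%E; apply: eq_integral => t; rewrite inE => tI.
    by rewrite GF.
  by rewrite HF.
- exact/measurable_EFinP.
- by move=> t _; rewrite lee_fin.
- apply/disj_setPS => t [/=]; rewrite !in_itv/= => /andP[_ tb] /andP[bt _].
  by have := lt_le_trans bt tb; rewrite ltxx.
Qed.

End two_pieces.

Section paths.
Variables (R : realType) (u : R * R -> R) (usmooth : smooth u).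
Local Notation mu := (@lebesgue_measure R).
Implicit Types (x y z w e : R * R) (gamma : R -> R * R) (a b t : R).

Definition ray w e (t : R) : R * R := w + t *: e.

Lemma is_derive_ray w e t v : is_derive t v (ray w e) (v *: e).
Proof.
have d1 : is_diff t (( *:%R)^~ e) (( *:%R)^~ e) := is_diff_scalel t e.
have d2 : is_diff t (cst w : R -> R * R) 0 := is_diff_cst w t.
have d := is_diffD d2 d1.
have rE : ray w e = cst w + ( *:%R)^~ e by [].
rewrite rE; split; first by apply: diff_derivable; case: d.
rewrite deriveE; last by case: d.
by rewrite diff_val add0r.
Qed.

Lemma smooth_ray w e : smooth (ray w e).
Proof.
move=> vs p.
suff [w' [e' ->]] : exists w' e', foldr (fun v h => 'D_v h) (ray w e) vs = ray w' e'.
  by apply/derivable1_diffP; case: (is_derive_ray w' e' p 1).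
elim: vs => [|v vs [w' [e' IH]]] /=; first by exists w, e.
exists (v *: e'), 0; rewrite IH; apply/funext => t.
by rewrite /ray scaler0 addr0; case: (is_derive_ray w' e' t v).
Qed.

Definition speed gamma t : R := expR (u (gamma t)) * euclidean_norm (derive1 gamma t).

Lemma speed_ge0 gamma t : (0 <= (speed gamma t)%:E)%E.
Proof. by rewrite lee_fin mulr_ge0 ?expR_ge0// sqrtr_ge0. Qed.

Lemma speed_near gamma c t : (\near t, gamma t = c t) -> speed gamma t = speed c t.
Proof.
by move=> h; rewrite /speed !derive1E (near_eq_derive _ h) (nbhs_singleton h).
Qed.

Lemma speed_ray w e t : speed (ray w e) t = expR (u (w + t *: e)) * euclidean_norm e.
Proof.
rewrite /speed derive1E.
by case: (is_derive_ray w e t 1) => _ ->; rewrite scale1r.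
Qed.

Lemma continuous_speed_ray w e : continuous (speed (ray w e)).
Proof.
rewrite (_ : speed _ = fun t => expR (u (ray w e t)) * euclidean_norm e); last first.
  by apply/funext => t; rewrite speed_ray.
move=> t; apply: cvgM; last exact: cvg_cst.
apply: (@continuous_comp _ _ _ (fun t => u (ray w e t)) expR); last exact: continuous_expR.
apply: continuous_comp; last exact: smooth_continuous.
by apply: differentiable_continuous; exact: (smooth_ray w e [::] t).
Qed.

Lemma measurable_speed_ray w e (A : set R) : measurable A -> measurable_fun A (speed (ray w e)).
Proof.
move=> mA; apply: (measurable_funS measurableT) => //.
by apply: continuous_measurable_fun; exact: continuous_speed_ray.
Qed.

(** Integrating over the open interval hides the values of the derivative at the
    ends, and measurability of the speed is what makes lengths additive under
    concatenation. *)
Definition joined x y (l : R) : Prop := exists a b gamma,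
  [/\ a < b, piecewise_smooth a b gamma, gamma a = x, gamma b = y &
   measurable_fun `]a, b[ (speed gamma) /\ (\int[mu]_(t in `]a, b[) (speed gamma t)%:E <= l%:E)%E].

Lemma joined_dist x y l : joined x y l -> (conformal_dist u x y <= l%:E)%E.
Proof.
move=> [a [b [g [ab pg ga gb [mg lg]]]]].
apply: le_trans (ereal_inf_lbound _) lg; exists a, b, g; split=> //.
rewrite [RHS](_ : _ = \int[mu]_(t in `[a, b]) (EFin \o speed g) t)%E//.
rewrite [RHS]integral_itv_bndoo//.
exact/measurable_EFinP.
Qed.

Lemma joined_refl x : joined x x 0.
Proof.
exists 0, 1, (ray x 0); rewrite /ray !scaler0 addr0; split=> //.
  exists [:: 1]; first exact: itv_partition1.
  by case=> // _; exists (ray x 0) => //; exact: smooth_ray.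
split; first exact: measurable_speed_ray.
rewrite integral0_eq// => t _.
by rewrite speed_ray /euclidean_norm/= expr0n/= addr0 sqrtr0 mulr0.
Qed.

Definition segment y z (b : R) : R -> R * R := ray (y - b *: (z - y)) (z - y).

(** The starting time b is arbitrary, so that the segment can be appended to any
    curve without reparametrising. *)
Definition segment_le y z (m : R) : Prop := forall b,
  (\int[mu]_(t in `]b, (b + 1)%R[) (speed (segment y z b) t)%:E <= m%:E)%E.

Lemma piecewise_smooth_extend a b gamma c : a < b -> piecewise_smooth a b gamma ->
  smooth c -> c b = gamma b ->
  piecewise_smooth a (b + 1) (fun t => if t <= b then gamma t else c t).
Proof.
move=> ab [s ps Hs] sc cb.
have bb1 : b < b + 1 by rewrite ltrDl.
have ps1 := itv_partition_cat ps (itv_partition1 bb1).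
exists (s ++ [:: b + 1]) => // i; rewrite size_cat/= addn1 ltnS leq_eqVlt.
have nthE j : (j <= size s)%N -> nth (b + 1) (a :: s ++ [:: b + 1]) j = nth b (a :: s) j.
  by move=> js; rewrite -cat_cons nth_cat/= ltnS js; apply: set_nth_default.
move=> /orP[/eqP ->|iS].
  exists c => // t.
  rewrite nthE// (itv_partition_nth_size b ps) /= nth_cat ltnn subnn/=.
  rewrite in_itv/= => /andP[bt _]; case: ifP => // tb.
  by rewrite (_ : t = b) ?cb//; apply: le_anti; rewrite tb.
have [ci sci Hci] := Hs i iS; exists ci => // t.
have e1 := nthE i.+1 iS; rewrite (nthE i (ltnW iS)) /= in e1 *; rewrite e1 => tI.
rewrite Hci//; case: ifP => // /negbT; rewrite -ltNge => bt.
move: tI; rewrite in_itv/= => /andP[_ tb]; have := lt_le_trans bt tb.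
have le : nth b s i <= b := itv_partition_nth_le (m := i.+1) iS ps.
by rewrite ltNge le.
Qed.

Lemma joined_extend x y z l m : joined x y l -> segment_le y z m -> joined x z (l + m).
Proof.
move=> [a [b [g [ab pg ga gb [mg lg]]]]] yz.
pose c := segment y z b.
pose g' t := if t <= b then g t else c t.
have cb : c b = g b by rewrite gb /c /segment /ray subrK.
have bb1 : b < b + 1 by rewrite ltrDl.
have sl t : t \in `]a, b[ -> speed g t = speed g' t.
  move=> tab; apply: speed_near.
  have := near_in_itvoo tab; apply: filterS => r; rewrite in_itv/= => /andP[_ rb].
  by rewrite /g' ltW.
have sr t : t \in `]b, b + 1[ -> speed c t = speed g' t.
  move=> tab; apply: speed_near.
  have := near_in_itvoo tab; apply: filterS => r; rewrite in_itv/= => /andP[br _].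
  by rewrite /g' leNgt br.
exists a, (b + 1), g'; split.
- by rewrite (lt_trans ab).
- exact: piecewise_smooth_extend (smooth_ray _ _) cb.
- by rewrite /g' (ltW ab).
- by rewrite /g' leNgt bb1/= /c /segment /ray scalerDl scale1r addrA subrK addrC subrK.
have g0 t : 0 <= speed g' t by rewrite -lee_fin speed_ge0.
have mc : measurable_fun `]b, b + 1[ (speed c) by exact: measurable_speed_ray.
have [mg' ->] := measurable_integral_two_pieces ab bb1 g0 mg mc sl sr.
by split=> //; rewrite EFinD leeD.
Qed.

End paths.

Section links.
Variables (R : realType) (u : R * R -> R) (usmooth : smooth u).
Local Notation mu := (@lebesgue_measure R).
Implicit Types (x y z w e : R * R) (l m : R).

(** In this form curves can be assembled by transitivity and symmetry, without
    concatenating or reversing them explicitly. *)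
Definition link y z m : Prop :=
  (forall w l, joined u w y l -> joined u w z (l + m)) /\
  (forall w l, joined u w z l -> joined u w y (l + m)).

Lemma link_sym y z m : link y z m -> link z y m.
Proof. by case. Qed.

Lemma link_trans z y w l m : link y z l -> link z w m -> link y w (l + m).
Proof.
move=> [h1 h2] [h3 h4]; split => v k.
  by move=> /h1/h3; rewrite addrA.
by move=> /h4/h2; rewrite (addrC l) addrA.
Qed.

Lemma link_segment y z m : segment_le u y z m -> segment_le u z y m -> link y z m.
Proof.
by move=> h1 h2; split => w l H; apply: (joined_extend usmooth H).
Qed.

Lemma joined_le x y l m : l <= m -> joined u x y l -> joined u x y m.
Proof.
move=> lm [a [b [g [ab pg ga gb [mg lg]]]]]; exists a, b, g; split=> //; split=> //.
by apply: le_trans lg _; rewrite lee_fin.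
Qed.

Lemma link_le y z l m : l <= m -> link y z l -> link y z m.
Proof.
by move=> lm [h1 h2]; split=> w k /= => [/h1|/h2]; apply: joined_le; rewrite lerD2l.
Qed.

Lemma link_refl x : link x x 0.
Proof. by split=> w l; rewrite addr0. Qed.

Lemma link_dist x y l : link x y l -> (conformal_dist u x y <= l%:E)%E.
Proof.
move=> [h _]; apply: joined_dist; rewrite -[l]add0r; apply: h.
exact: joined_refl.
Qed.

Lemma link_chain (p : nat -> R * R) (m : nat -> R) M :
  (forall k, (k < M)%N -> link (p k) (p k.+1) (m k)) ->
  link (p 0%N) (p M) (\sum_(k < M) m k).
Proof.
elim: M => [|M IH] H; first by rewrite big_ord0; exact: link_refl.
rewrite big_ord_recr/=; apply: link_trans (H M _) => //.
by apply: IH => k kM; apply: H; exact: ltnW.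
Qed.

Lemma segment_le_sup y z m :
  (forall t, 0 <= t <= 1 -> expR (u (y + t *: (z - y))) * euclidean_norm (z - y) <= m) ->
  segment_le u y z m.
Proof.
move=> H b.
have m0 : 0 <= m.
  by apply: le_trans (H 0 _); rewrite ?lexx ?ler01// mulr_ge0 ?expR_ge0// sqrtr_ge0.
have mI : measurable (`]b, b + 1[%classic : set R) by exact: measurable_itv.
apply: (@le_trans _ _ (\int[mu]_(t in `]b, (b + 1)%R[) (cst m%:E) t)%E).
  apply: ge0_le_integral => //.
  - by move=> t _; exact: speed_ge0.
  - by apply/measurable_EFinP; exact: measurable_speed_ray.
  - move=> t /=; rewrite in_itv/= => /andP[bt tb].
    rewrite lee_fin speed_ray -addrA -scaleNr -scalerDl addrC.
    rewrite addrC [X in X *: _]addrC; apply: H; lra.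
rewrite integral_cst//= lebesgue_measure_itv/= lte_fin ltrDl ltr01 -EFinB.
by rewrite addrAC subrr add0r mule1.
Qed.

Lemma euclidean_normN e : euclidean_norm (- e) = euclidean_norm e.
Proof. by rewrite /euclidean_norm/= !sqrrN. Qed.

Lemma link_sup y z m :
  (forall t, 0 <= t <= 1 -> expR (u (y + t *: (z - y))) * euclidean_norm (z - y) <= m) ->
  link y z m.
Proof.
move=> H; apply: link_segment; apply: segment_le_sup => // t t01.
rewrite -opprB euclidean_normN scalerN.
have -> : z - t *: (z - y) = y + (1 - t) *: (z - y).
  by rewrite scalerBl scale1r addrA [y + (z - y)]addrC subrK.
apply: H; lra.
Qed.

(** The steps of the chain have size O(1/N), so that e^u changes along each of them at
    most by a factor 1 + eps. *)
Lemma chain_link S K (eps : R) : 0 < eps ->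
  exists N0 : nat, forall N M p, (N0 <= N)%N ->
  (forall k, (k <= M)%N -> square S (p k)) ->
  (forall k, (k < M)%N -> `|(vel N p k).1| <= K /\ `|(vel N p k).2| <= K) ->
  link (p 0%N) (p M) ((1 + eps) * \sum_(k < M) expR (u (p k)) * euclidean_norm (p k.+1 - p k)).
Proof.
move=> eps0.
have [C C0 HC] := square_lipschitz S usmooth.
have e1 : 1 < 1 + eps by rewrite ltrDl.
pose del := ln (1 + eps).
have del0 : 0 < del by exact: ln_gt0.
pose Q := C * (K + K) / del.
exists (Num.truncn Q).+1 => N M p NQ sq velK.
have N0 : 0 < N%:R :> R by rewrite ltr0n (leq_trans _ NQ).
have {}NQ : Q < N%:R.
  by rewrite (lt_le_trans (truncnS_gt Q))// ler_nat.
rewrite mulr_sumr.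
apply: (@link_chain p (fun k => (1 + eps) * (expR (u (p k)) * euclidean_norm (p k.+1 - p k)))).
move=> k kM; apply: link_sup => t t01.
rewrite mulrA ler_wpM2r ?sqrtr_ge0//.
have [v1 v2] := velK k kM.
have sk := sq k (ltnW kM); have sk1 := sq k.+1 kM.
have st := square_segment sk sk1 t01.
have l1v : l1 (p k + t *: (p k.+1 - p k) - p k) <= (K + K) / N%:R.
  rewrite addrC addKr /l1/= !normrM ler_pdivlMr// mulrDl.
  have h (a : R) : `|N%:R * a| <= K -> `|t| * `|a| * N%:R <= K.
    rewrite normrM ger0_norm ?ler0n// => ha; rewrite (le_trans _ ha)//.
    rewrite -mulrA [X in _ * X]mulrC ler_piMl ?mulr_ge0//; move: t01 => /andP[t0 t1].
    by rewrite ger0_norm.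
  by rewrite lerD// h.
have := HC _ _ sk st; set z := p k + _ => hz.
have {}hz : u z <= u (p k) + del.
  rewrite -lerBlDl (le_trans (ler_norm _))// (le_trans hz)//.
  rewrite (le_trans (ler_wpM2l C0 l1v))// mulrA ler_pdivrMr// [del * _]mulrC -ler_pdivrMr//.
  exact: ltW.
by rewrite mulrC -[1 + eps]lnK ?posrE ?(lt_trans ltr01)// -expRD ler_expR.
Qed.

End links.

(** * Area and short lines *)

Section plane_measurability.
Variable R : realType.

(** An open set is the countable union of the boxes with rational centre and size
    that it contains, and boxes are measurable for the product. *)
Lemma open_measurable_plane (O : set (R * R)) : open O -> measurable O.
Proof.
move=> oO.
pose box (q r e : rat) : set (R * R) :=
  `](ratr q - ratr e : R), (ratr q + ratr e : R)[%classic `*` `](ratr r - ratr e : R), (ratr r + ratr e : R)[%classic.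
pose U q r e : set (R * R) := if `[< box q r e `<=` O >] then box q r e else set0.
have -> : O = \bigcup_q \bigcup_r \bigcup_e U q r e.
  apply/seteqP; split => [p Op|p [q _ [r _ [e _]]]]; last first.
    by rewrite /U; case: asboolP => // h /h.
  have /nbhs_ballP[d /= d0 Hd] : nbhs p O by exact: open_nbhs_nbhs.
  have d2 : 0 < d / 2 by rewrite divr_gt0.
  have [e] := rat_in_itvoo d2; rewrite in_itv/= => /andP[e0 ed].
  have [q] : exists q : rat, (ratr q : R) \in `]p.1 - ratr e, p.1 + ratr e[.
    by apply: rat_in_itvoo; rewrite ltrBlDr -addrA ltrDl addr_gt0.
  have [r] : exists q : rat, (ratr q : R) \in `]p.2 - ratr e, p.2 + ratr e[.
    by apply: rat_in_itvoo; rewrite ltrBlDr -addrA ltrDl addr_gt0.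
  rewrite !in_itv/= => /andP[r1 r2] /andP[q1 q2].
  exists q => //; exists r => //; exists e => //; rewrite /U; case: asboolP => [_|].
    by split; rewrite /= in_itv/=; apply/andP; split; lra.
  case=> z [/=]; rewrite !in_itv/= => /andP[z1 z2] /andP[z3 z4]; apply: Hd.
  by split; rewrite /ball/= ltr_norml; apply/andP; split; lra.
apply: bigcupT_measurable_rat => q; apply: bigcupT_measurable_rat => r.
apply: bigcupT_measurable_rat => e; rewrite /U; case: asboolP => // _.
by apply: measurableX; exact: measurable_itv.
Qed.

Lemma continuous_measurable_plane (f : R * R -> R) :
  continuous f -> measurable_fun setT f.
Proof.
move=> /continuousP cf; apply: (measurability _ (RGenOpens.measurableE R)).
move=> _ [_ [a [b ->] <-]]; rewrite setTI; apply: open_measurable_plane.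
exact/cf/interval_open.
Qed.

End plane_measurability.

Section harmonic.
Variable R : realType.
Local Notation mu := (@lebesgue_measure R).

Lemma integral_inv (a b c : R) : 0 < a -> a < b ->
  (\int[mu]_(x in `[a, b]) (c / x)%:E = (c * ln b - c * ln a)%:E)%E.
Proof.
move=> a0 ab.
have dF (x : R) : 0 < x -> is_derive x 1 (fun x => c * ln x) (c / x).
  by move=> x0; have h := is_derive1_ln x0; exact: is_deriveZ.
have cF (x : R) : 0 < x -> {for x, continuous (fun x => c * ln x)}.
  move=> x0; apply: differentiable_continuous; apply/derivable1_diffP.
  by case: (dF x x0).
rewrite (@continuous_FTC2 _ (fun x => c / x) (fun x => c * ln x) a b ab) ?EFinB//.
- apply: continuous_in_subspaceT => x; rewrite inE/= in_itv/= => /andP[ax _].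
  have x0 : x != 0 by rewrite gt_eqF// (lt_le_trans a0).
  by apply: cvgM; [exact: cvg_cst|exact: cvgV].
- split=> [x| |].
  + by rewrite in_itv/= => /andP[ax _]; case: (dF x (lt_trans a0 ax)).
  + by apply: cvg_at_right_filter; exact: cF.
  + by apply: cvg_at_left_filter; apply: cF; exact: lt_trans ab.
- move=> x; rewrite in_itv/= => /andP[ax _]; rewrite derive1E.
  by case: (dF x (lt_trans a0 ax)) => _ ->.
Qed.

(** Otherwise H would exceed c / x from some point s1 on, and the integral of c / x
    diverges; T is chosen to make it exceed that of H. *)
Lemma integrable_below_harmonic (H : R -> \bar R) (c s0 : R) :
  measurable_fun setT H -> (forall x, 0 <= H x)%E ->
  (\int[mu]_(x in `[0%R, +oo[) H x < +oo)%E -> 0 < c ->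
  exists s, [/\ s0 < s, 0 < s & (H s <= (c / s)%:E)%E].
Proof.
move=> mH H0 Hoo c0; apply: contrapT => nex.
pose s1 := Num.max s0 0 + 1.
have s10 : 0 < s1 by rewrite /s1 ltr_wpDl// le_max lexx orbT.
have big x : s1 <= x -> ((c / x)%:E <= H x)%E.
  move=> sx; have [//|/ltW h] := leP (c / x)%:E (H x).
  exfalso; apply: nex; exists x; split=> //.
    by rewrite (lt_le_trans _ sx)// /s1 (le_lt_trans (y := Num.max s0 0)) ?le_max ?lexx// ltrDl.
  exact: lt_le_trans sx.
have [I IE] : exists I : R, (\int[mu]_(x in `[0%R, +oo[) H x = I%:E)%E.
  have : (\int[mu]_(x in `[0%R, +oo[) H x)%E \is a fin_num.
    by rewrite ge0_fin_numE//; apply: integral_ge0.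
  by move=> /fineK <-; eexists.
pose T := s1 * expR ((`|I| + 1) / c).
have sT : s1 < T.
  by rewrite /T ltr_pMr// -expR0 ltr_expR divr_gt0// ltr_wpDl.
have : ((c * ln T - c * ln s1)%:E <= I%:E)%E.
  rewrite -integral_inv// -IE.
  apply: (@le_trans _ _ (\int[mu]_(x in `[s1, T]) H x)%E).
    apply: ge0_le_integral => //.
    - move=> x /=; rewrite in_itv/= => /andP[sx _].
      by rewrite lee_fin divr_ge0 ?ltW// (lt_le_trans s10).
    - apply/measurable_EFinP; apply: subspace_continuous_measurable_fun => //.
      apply: continuous_in_subspaceT => x; rewrite inE/= in_itv/= => /andP[ax _].
      have x0 : x != 0 by rewrite gt_eqF// (lt_le_trans s10).
      by apply: cvgM; [exact: cvg_cst|exact: cvgV].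
    - exact: measurable_funS mH.
    - by move=> x /=; rewrite in_itv/= => /andP[sx _]; exact: big.
  apply: ge0_subset_integral => //; first exact: measurable_funS mH.
  move=> x /=; rewrite !in_itv/= => /andP[sx _].
  by rewrite (le_trans _ sx)// ltW.
rewrite lee_fin /T lnM ?posrE ?expR_gt0// expRK mulrDr addrAC subrr add0r.
rewrite mulrCA mulfV ?gt_eqF// mulr1 => h.
by have := ler_norm I; lra.
Qed.

End harmonic.

Section reflected_tails.
Variable R : realType.
Local Notation mu := (@lebesgue_measure R).

(** Lebesgue measure is invariant under the reflection x |-> - x. *)
Lemma half_line_le (G : R -> \bar R) : measurable_fun setT G -> (forall x, 0 <= G x)%E ->
  (\int[mu]_(x in `[0%R, +oo[) G x <= \int[mu]_x G x)%E /\
  (\int[mu]_(x in `[0%R, +oo[) G (- x)%R <= \int[mu]_x G x)%E.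
Proof.
move=> mG G0; split; first by apply: ge0_subset_integral.
pose G' x := G (- x).
have mG' : measurable_fun setT G'.
  by apply: (measurableT_comp mG); exact: oppr_measurable.
have -> : (\int[mu]_(x in `[0%R, +oo[) G (- x)%R = \int[mu]_(x in `]-oo, 0%R]) G x)%E.
  rewrite (ge0_integration_by_substitution0 mG') => [|x]; last exact: G0.
  by apply: eq_integral => x _; rewrite /G' opprK.
by apply: ge0_subset_integral.
Qed.

Lemma reflected_tails (F G : R -> \bar R) (c s0 : R) :
  measurable_fun setT F -> (forall x, 0 <= F x)%E -> (\int[mu]_x F x < +oo)%E ->
  measurable_fun setT G -> (forall x, 0 <= G x)%E -> (\int[mu]_x G x < +oo)%E ->
  0 < c -> exists S, [/\ s0 < S, 0 < S &
  [/\ (F S <= (c / S)%:E)%E, (F (- S)%R <= (c / S)%:E)%E,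
      (G S <= (c / S)%:E)%E & (G (- S)%R <= (c / S)%:E)%E]].
Proof.
move=> mF F0 FI mG G0 GI c0.
have mN (K : R -> \bar R) : measurable_fun setT K -> measurable_fun setT (fun s : R => K (- s)).
  by move=> mK; apply: (measurableT_comp mK); exact: oppr_measurable.
have mFN := mN _ mF; have mGN := mN _ mG.
have mFF := emeasurable_funD mF mFN; have mGG := emeasurable_funD mG mGN.
pose H s := (F s + F (- s)%R + (G s + G (- s)%R))%E.
have mH : measurable_fun setT H := emeasurable_funD mFF mGG.
have [f1 f2] := half_line_le mF F0; have [g1 g2] := half_line_le mG G0.
have mS (K : R -> \bar R) : measurable_fun setT K -> measurable_fun (`[0%R, +oo[%classic : set R) K.
  by move=> mK; exact: measurable_funS mK.
have HI : (\int[mu]_(x in `[0%R, +oo[) H x < +oo)%E.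
  rewrite /H ge0_integralD//=; [|by move=> x _; exact: adde_ge0|exact: mS|by move=> x _; exact: adde_ge0|exact: mS].
  rewrite !ge0_integralD//=; try exact: mS.
  have := (le_lt_trans f1 FI, le_lt_trans f2 FI, le_lt_trans g1 GI, le_lt_trans g2 GI).
  by move=> [[[h1 h2] h3] h4]; exact: lte_add_pinfty (lte_add_pinfty h1 h2) (lte_add_pinfty h3 h4).
have [S [sS S0 HS]] := integrable_below_harmonic s0 mH (fun x => adde_ge0 (adde_ge0 (F0 _) (F0 _)) (adde_ge0 (G0 _) (G0 _))) HI c0.
have A0 : (0 <= F S + F (- S)%R)%E by exact: adde_ge0.
have B0 : (0 <= G S + G (- S)%R)%E by exact: adde_ge0.
have HA : (F S + F (- S)%R <= (c / S)%:E)%E by apply: le_trans HS; rewrite leeDl.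
have HB : (G S + G (- S)%R <= (c / S)%:E)%E by apply: le_trans HS; rewrite leeDr.
exists S; split=> //; split.
- by apply: le_trans HA; rewrite leeDl.
- by apply: le_trans HA; rewrite leeDr.
- by apply: le_trans HB; rewrite leeDl.
- by apply: le_trans HB; rewrite leeDr.
Qed.

End reflected_tails.

Section lines.
Variables (R : realType) (u : R * R -> R) (usmooth : smooth u).
Local Notation mu := (@lebesgue_measure R).
Hypothesis uarea : (\int[(mu \x mu)%E]_p (expR (2 * u p))%:E < +oo)%E.

Let f (p : R * R) : \bar R := (expR (2 * u p))%:E.

Let mf : measurable_fun setT f.
Proof.
apply/measurable_EFinP; apply: continuous_measurable_plane => p.
apply: (@continuous_comp _ _ _ (fun p => 2 * u p) expR); last exact: continuous_expR.
have h := @smooth_continuous _ _ usmooth p.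
exact: cvgM (@cvg_cst _ _ _ _ _) h.
Qed.

Let f0 p : (0 <= f p)%E. Proof. by rewrite lee_fin expR_ge0. Qed.

(** F s and G s are the integrals of e^{2u} over the vertical and the horizontal line
    at position s; by Fubini both are integrable. *)
Lemma short_lines (c s0 : R) : 0 < c -> exists S, [/\ s0 < S, 0 < S &
  [/\ (\int[mu]_t f (S, t)%R <= (c / S)%:E)%E, (\int[mu]_t f (- S, t)%R <= (c / S)%:E)%E,
      (\int[mu]_t f (t, S)%R <= (c / S)%:E)%E & (\int[mu]_t f (t, - S)%R <= (c / S)%:E)%E]].
Proof.
move=> c0.
pose F s := (\int[mu]_t f (s, t)%R)%E; pose G s := (\int[mu]_t f (t, s)%R)%E.
have mF : measurable_fun setT F by exact: (measurable_fun_fubini_tonelli_F (m2 := mu) f mf f0).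
have mG : measurable_fun setT G by exact: (measurable_fun_fubini_tonelli_G (m1 := mu) f mf f0).
have F0 s : (0 <= F s)%E by apply: integral_ge0.
have G0 s : (0 <= G s)%E by apply: integral_ge0.
have FI : (\int[mu]_s F s < +oo)%E.
  by have := fubini_tonelli1 (m1 := mu) (m2 := mu) f mf f0; rewrite /fubini_F => <-.
have GI : (\int[mu]_s G s < +oo)%E.
  by have := fubini_tonelli2 (m1 := mu) (m2 := mu) f mf f0; rewrite /fubini_G => <-.
exact: reflected_tails mF F0 FI mG G0 GI c0.
Qed.

End lines.

(** * The boundary of a large square is short, and the diameter *)

Section sides.
Variables (R : realType) (u : R * R -> R) (usmooth : smooth u).
Local Notation mu := (@lebesgue_measure R).

Lemma integral_affine_substitution (w : R -> R) (s0 s1 b : R) : continuous w -> s0 != s1 ->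
  (\int[mu]_(t in `[b, (b + 1)%R]) (w (s0 + (t - b) * (s1 - s0)) * `|s1 - s0|)%:E =
   \int[mu]_(t in `[(Num.min s0 s1), (Num.max s0 s1)]) (w t)%:E)%E.
Proof.
move=> cw s01; pose F (t : R) := s0 + (t - b) * (s1 - s0).
have dF (t : R) : is_derive t 1 F (s1 - s0).
  have h := is_derive_affine (s0 - b * (s1 - s0)) (s1 - s0) t.
  rewrite (_ : F = fun t => s0 - b * (s1 - s0) + t * (s1 - s0))//.
  by apply/funext => r; rewrite /F; ring.
have F' : F^`()%classic = cst (s1 - s0).
  by apply/funext => t; rewrite derive1E; case: (dF t) => _ ->.
have cF : continuous F.
  by move=> t; apply: differentiable_continuous; apply/derivable1_diffP; case: (dF t).
have bb : b <= b + 1 by rewrite lerDl.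
have Fb : F b = s0 by rewrite /F subrr mul0r addr0.
have Fb1 : F (b + 1) = s1 by rewrite /F addrAC subrr add0r mul1r addrC subrK.
have dLR : derivable_oo_LRcontinuous F b (b + 1).
  split=> [t _| |]; first by case: (dF t).
    by apply: cvg_at_right_filter; exact: cF.
  by apply: cvg_at_left_filter; exact: cF.
have c1 : {in `]b, b + 1[, continuous F^`()%classic} by move=> t _; rewrite F'; exact: cst_continuous.
have c2 : cvg (F^`()%classic x @[x --> b^'+]) by rewrite F'; exact: is_cvg_cst.
have c3 : cvg (F^`()%classic x @[x --> (b + 1)^'-]) by rewrite F'; exact: is_cvg_cst.
have [lt|gt|eq] := ltgtP s0 s1; last by rewrite eq eqxx in s01.
- have inc : {in `[b, b + 1] &, {homo F : x y / x < y}}.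
    by move=> t t' _ _ tt; rewrite /F ltrD2l ltr_pM2r ?subr_gt0// ltrD2r.
  have := @integration_by_substitution_increasing _ F w b (b + 1) bb inc c1 c2 c3 dLR (continuous_subspaceT cw).
  rewrite Fb Fb1 => ->; apply: eq_integral => t _.
  by rewrite F' ger0_norm// subr_ge0 ltW.
- have dec : {in `[b, b + 1] &, {homo F : x y /~ x < y}}.
    by move=> t t' _ _ tt; rewrite /F ltrD2l ltr_nM2r ?subr_lt0// ltrD2r.
  have := @integration_by_substitution_decreasing _ F w b (b + 1) bb dec c1 c2 c3 dLR (continuous_subspaceT cw).
  rewrite Fb Fb1 => ->; apply: eq_integral => t _.
  by rewrite F' ler0_norm// subr_le0 ltW.
Qed.

(** Pointwise w <= lam w^2 / 2 + 1 / (2 lam); lam = 2 S / eta makes the integrals of the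
    two terms over an interval of length 2 S equal to at most eta / 2 each. *)
Lemma side_length_le (w : R -> R) (S eta : R) : continuous w -> (forall t, 0 <= w t) ->
  0 < S -> 0 < eta -> (\int[mu]_t (w t ^+ 2)%:E <= (eta ^+ 2 / 2 / S)%:E)%E ->
  (\int[mu]_(t in `[(- S)%R, S]) (w t)%:E <= eta%:E)%E.
Proof.
move=> cw w0 S0 eta0 hw.
have mI : measurable (`[- S, S]%classic : set R) by exact: measurable_itv.
have mw : measurable_fun setT w by exact: continuous_measurable_fun.
have mw2 : measurable_fun setT (fun t => w t ^+ 2).
  by apply: continuous_measurable_fun => t; apply: cvgM; exact: cw.
pose lam := 2 * S / eta.
have lam0 : 0 < lam by rewrite divr_gt0// mulr_gt0.
pose k1 := lam / 2; pose k2 := (2 * lam)^-1.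
have k10 : 0 <= k1 by rewrite divr_ge0// ltW.
have k20 : 0 <= k2 by rewrite invr_ge0 mulr_ge0// ltW.
apply: (@le_trans _ _ (\int[mu]_(t in `[(- S)%R, S]) (k1%:E * (w t ^+ 2)%:E + (cst k2%:E) t))%E).
  apply: ge0_le_integral => //.
  - by move=> t _; rewrite lee_fin.
  - by apply/measurable_EFinP; exact: measurable_funS mw.
  - apply: emeasurable_funD => //; apply: measurable_funeM.
    by apply/measurable_EFinP; exact: measurable_funS mw2.
  - move=> t _; rewrite /= -EFinM -EFinD lee_fin /k1 /k2.
    have h : 0 <= (lam * w t - 1) ^+ 2 / (2 * lam).
      by rewrite divr_ge0 ?sqr_ge0// mulr_ge0// ltW.
    rewrite -subr_ge0 (_ : _ - w t = (lam * w t - 1) ^+ 2 / (2 * lam))//.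
    by field; rewrite gt_eqF.
rewrite ge0_integralD//=; last 2 first.
- by move=> t _; rewrite -EFinM lee_fin mulr_ge0// sqr_ge0.
- by apply: measurable_funeM; apply/measurable_EFinP; exact: measurable_funS mw2.
rewrite ge0_integralZl_EFin//; last 2 first.
- by move=> t _; rewrite lee_fin sqr_ge0.
- by apply/measurable_EFinP; exact: measurable_funS mw2.
rewrite integral_cst//= lebesgue_measure_itv/= lte_fin gt0_cp// -EFinB -EFinM.
have h : (\int[mu]_(t in `[(- S)%R, S]) (w t ^+ 2)%:E <= (eta ^+ 2 / 2 / S)%:E)%E.
  apply: le_trans hw; apply: ge0_subset_integral => //.
  - exact/measurable_EFinP.
  - by move=> t _; rewrite lee_fin sqr_ge0.
apply: (@le_trans _ _ (k1%:E * (eta ^+ 2 / 2 / S)%:E + (k2 * (S - - S))%:E)%E).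
  by rewrite leeD2r// lee_wpmul2l// lee_fin.
rewrite -EFinM -EFinD lee_fin /k1 /k2 /lam le_eqVlt; apply/orP; left; apply/eqP.
by field; rewrite !gt_eqF.
Qed.

Lemma side_segment_le (z e : R * R) (S eta s0 s1 : R) : euclidean_norm e = 1 ->
  0 < S -> 0 < eta -> `|s0| <= S -> `|s1| <= S ->
  (\int[mu]_t (expR (2 * u (z + t *: e)))%:E <= (eta ^+ 2 / 2 / S)%:E)%E ->
  segment_le u (z + s0 *: e) (z + s1 *: e) eta.
Proof.
move=> e1 S0 eta0 s0S s1S hw b.
pose w t := expR (u (z + t *: e)).
have cw : continuous w.
  rewrite /w => t; apply: (@continuous_comp _ _ _ (fun t : R => u (z + t *: e)) expR); last exact: continuous_expR.
  by apply: differentiable_continuous; apply/derivable1_diffP; case: (is_derive_line z e t usmooth).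
have w0 t : 0 <= w t by exact: expR_ge0.
have hw2 : (\int[mu]_t (w t ^+ 2)%:E <= (eta ^+ 2 / 2 / S)%:E)%E.
  by apply: le_trans hw; under eq_integral do rewrite /w -expRM_natl.
have len := side_length_le cw w0 S0 eta0 hw2.
have dE : z + s1 *: e - (z + s0 *: e) = (s1 - s0) *: e.
  by rewrite opprD addrACA subrr add0r scalerBl.
have nE : euclidean_norm ((s1 - s0) *: e) = `|s1 - s0|.
  rewrite /euclidean_norm/= /GRing.scale/= !exprMn -mulrDr sqrtrM ?sqr_ge0//.
  by rewrite sqrtr_sqr -[Num.sqrt _]/(euclidean_norm e) e1 mulr1.
have sE t : speed u (segment (z + s0 *: e) (z + s1 *: e) b) t =
   w (s0 + (t - b) * (s1 - s0)) * `|s1 - s0|.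
  rewrite speed_ray dE nE /w; congr (expR (u _) * _).
  rewrite !scalerA -scaleNr -!addrA -!scalerDl; congr (_ + _ *: e); ring.
under eq_integral do rewrite sE.
have [->|s01] := eqVneq s0 s1.
  under eq_integral do rewrite subrr normr0 mulr0.
  by rewrite integral0 lee_fin ltW.
rewrite -(@integral_itv_bndoo _ b (b + 1) _ true false); last first.
  apply/measurable_EFinP; apply: (eq_measurable_fun (speed u (segment (z + s0 *: e) (z + s1 *: e) b))).
    by move=> t _; rewrite sE.
  exact: measurable_speed_ray.
rewrite (integral_affine_substitution b cw s01).
apply: le_trans len; apply: ge0_subset_integral => //.
- by apply/measurable_EFinP; apply: measurable_funS (continuous_measurable_fun cw).
- by move=> t _; rewrite lee_fin.
- move=> t /=; rewrite !in_itv/= => /andP[t1 t2].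
  move: s0S s1S; rewrite !ler_norml => /andP[a1 a2] /andP[a3 a4].
  by rewrite (le_trans _ t1) ?le_min ?a1// (le_trans t2)// ge_max a2.
Qed.

Lemma side_link (z e : R * R) (S eta s0 s1 : R) : euclidean_norm e = 1 ->
  0 < S -> 0 < eta -> `|s0| <= S -> `|s1| <= S ->
  (\int[mu]_t (expR (2 * u (z + t *: e)))%:E <= (eta ^+ 2 / 2 / S)%:E)%E ->
  link u (z + s0 *: e) (z + s1 *: e) eta.
Proof. by move=> *; apply: link_segment => //; apply: (@side_segment_le _ _ S). Qed.

(** From the right or the upper side the corner (S, S) is reached along that side;
    from the other two, by way of one more corner. *)
Lemma boundary_link (S eta : R) (q : R * R) : 0 < S -> 0 < eta ->
  [/\ (\int[mu]_t (expR (2 * u (S, t)%R))%:E <= (eta ^+ 2 / 2 / S)%:E)%E,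
      (\int[mu]_t (expR (2 * u (- S, t)%R))%:E <= (eta ^+ 2 / 2 / S)%:E)%E,
      (\int[mu]_t (expR (2 * u (t, S)%R))%:E <= (eta ^+ 2 / 2 / S)%:E)%E &
      (\int[mu]_t (expR (2 * u (t, - S)%R))%:E <= (eta ^+ 2 / 2 / S)%:E)%E] ->
  square S q -> on_boundary S q -> link u q (S, S) (eta + eta).
Proof.
move=> S0 eta0 [h1 h2 h3 h4] [q1 q2] bq.
have e10 : euclidean_norm ((1, 0) : R * R) = 1.
  by rewrite /euclidean_norm/= expr1n expr0n addr0 sqrtr1.
have e01 : euclidean_norm ((0, 1) : R * R) = 1.
  by rewrite /euclidean_norm/= expr1n expr0n add0r sqrtr1.
have SS : `|S| <= S by rewrite ger0_norm// ltW.
have NS : `|- S| <= S by rewrite normrN.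
have vE (a t : R) : (a, 0) + t *: (0, 1) = (a, t) :> R * R.
  by apply: injective_projections; rewrite /= /GRing.scale/= ?mulr0 ?mulr1 ?addr0 ?add0r.
have hE (a t : R) : (0, a) + t *: (1, 0) = (t, a) :> R * R.
  by apply: injective_projections; rewrite /= /GRing.scale/= ?mulr0 ?mulr1 ?addr0 ?add0r.
have V (a s0 s1 : R) : `|s0| <= S -> `|s1| <= S ->
  (\int[mu]_t (expR (2 * u (a, t)%R))%:E <= (eta ^+ 2 / 2 / S)%:E)%E -> link u (a, s0) (a, s1) eta.
  move=> s0S s1S h; have := @side_link (a, 0) (0, 1) S eta s0 s1 e01 S0 eta0 s0S s1S.
  by rewrite !vE; under eq_integral do rewrite vE; exact.
have Hh (a s0 s1 : R) : `|s0| <= S -> `|s1| <= S ->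
  (\int[mu]_t (expR (2 * u (t, a)%R))%:E <= (eta ^+ 2 / 2 / S)%:E)%E -> link u (s0, a) (s1, a) eta.
  move=> s0S s1S h; have := @side_link (0, a) (1, 0) S eta s0 s1 e10 S0 eta0 s0S s1S.
  by rewrite !hE; under eq_integral do rewrite hE; exact.
have eta2 : eta <= eta + eta by rewrite lerDl ltW.
have absE (a : R) : `|a| = S -> a = S \/ a = - S.
  by move=> <-; case: (ger0P a) => _; [left|right; rewrite opprK].
move: q1 q2 bq; case: q => a b /= q1 q2; rewrite /on_boundary/= => /orP[/eqP/absE[->|->]|/eqP/absE[->|->]].
- by apply: link_le eta2 _; exact: V.
- by apply: (link_trans (z := (- S, S))); [exact: V|exact: Hh].
- by apply: link_le eta2 _; exact: Hh.
- by apply: (link_trans (z := (S, - S))); [exact: Hh|exact: V].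
Qed.

End sides.

Section diameter.
Variables (R : realType) (u : R * R -> R) (usmooth : smooth u).
Hypothesis ucurv : forall p : R * R, laplacian u p + expR (2 * u p) <= 0.

Lemma link_to_boundary (S : R) (x : R * R) (del : R) : `|x.1| < S -> `|x.2| < S -> 0 < del ->
  exists q, [/\ square S q, on_boundary S q & link u x q ((1 + del) * (pi + del))].
Proof.
move=> x1 x2 del0.
have [E [d [E0 d0 H]]] := discrete_geodesic_exists usmooth x1 x2.
have [N1 H1] := discrete_geodesic_length usmooth ucurv S E0 d0 del0.
have [K K0 HK] := velocity_bound usmooth S E0 d0.
have [N2 H2] := chain_link usmooth S K del0.
pose N := (maxn N1 N2).+1.
have [M [p [dg p0 pM]]] := H N isT.
exists (p M); split=> //; first exact: dg.(dg_square).
have [_ vK] := HK _ _ _ dg.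
rewrite -p0; apply: link_le (H2 N M p _ _ vK); last 2 first.
- by rewrite leqW// leq_maxr.
- exact: dg.(dg_square).
apply: ler_wpM2l; first by rewrite addr_ge0 ?(ltW del0).
apply: (H1 N M p _ dg).
by rewrite leqW// leq_maxl.
Qed.

Hypothesis uarea : (\int[(@lebesgue_measure R \x @lebesgue_measure R)%E]_p
  (expR (2 * u p))%:E < +oo)%E.

(** From x and from y to the boundary of one and the same square, and along its
    boundary through the corner (S, S). *)
Lemma conformal_dist_le (x y : R * R) (eps : R) : 0 < eps ->
  (conformal_dist u x y <= (2 * pi + eps)%:E)%E.
Proof.
move=> eps0.
have p0 := @pi_ge0 R.
pose eta := eps / 8; pose del := Num.min 1 (eps / (4 * (pi + 2))).
have eta0 : 0 < eta by rewrite divr_gt0.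
have p20 : 0 < 4 * (pi + 2) :> R by rewrite mulr_gt0// ltr_wpDl.
have del0 : 0 < del by rewrite lt_min ltr01 divr_gt0.
have del1 : del <= 1 by rewrite ge_min lexx.
have dele : del * (4 * (pi + 2)) <= eps by rewrite -ler_pdivlMr// ge_min lexx orbT.
pose s0 := Num.max (Num.max `|x.1| `|x.2|) (Num.max `|y.1| `|y.2|).
have c0 : 0 < eta ^+ 2 / 2 by rewrite divr_gt0// exprn_gt0.
have [S [sS S0 lines]] := short_lines usmooth uarea s0 c0.
move: sS; rewrite !gt_max => /andP[/andP[x1 x2] /andP[y1 y2]].
have [qx [Kx bx lx]] := link_to_boundary x1 x2 del0.
have [qy [Ky by' ly]] := link_to_boundary y1 y2 del0.
have cx := boundary_link usmooth S0 eta0 lines Kx bx.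
have cy := boundary_link usmooth S0 eta0 lines Ky by'.
have l := link_trans (link_trans lx cx) (link_sym (link_trans ly cy)).
apply: le_trans (link_dist usmooth l) _; rewrite lee_fin /eta.
have := ler_wpM2l (ltW del0) del1; lra.
Qed.

End diameter.

Theorem theorem1p4 (R : realType) (u : R * R -> R)
  (usmooth : smooth u)
  (ucurv : forall p : R * R, laplacian u p + expR (2 * u p) <= 0)
  (uarea : (\int[(@lebesgue_measure R \x @lebesgue_measure R)%E]_p
              (expR (2 * u p))%:E < +oo)%E) :
  (conformal_diam u <= (2 * pi)%:E)%E.
Proof.
apply: ub_ereal_sup => _ [x [y ->]].
by apply/lee_addgt0Pr => eps eps0; rewrite -EFinD; exact: conformal_dist_le.
Qed.
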